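(* Let $\Omega=(a,b)\subset\mathbb{R}$ be a bounded open interval, $f\in BV(\Omega)$, $\alpha_1\in C(\overline\Omega)$ with $\alpha_1>0$ on $\overline\Omega$, and let $\alpha_2>0$ be a scalar (constant). Then $$S_{\alpha_1+\alpha_2}(f)=S_{\alpha_2}\big(S_{\alpha_1}(f)\big).$$
   Context: For $g\in BV(\Omega)$ and $\alpha\in C(\overline\Omega)$ with $\alpha>0$, $S_\alpha(g)\in BV(\Omega)$ denotes the unique minimiser $$S_\alpha(g):=\operatorname*{argmin}_{u\in BV(\Omega)}\ \frac12\int_\Omega (g-u)^2\,dx+\int_\Omega\alpha(x)\,d|Du|,$$ where $|Du|$ is the total variation measure of the distributional derivative $Du$. A scalar is identified with a constant weight function. *)

(* Defs.v *)
From HB Require Import structures.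
From mathcomp Require Import all_boot all_order all_algebra.
From mathcomp Require Import all_classical all_reals all_analysis.

Set Implicit Arguments.
Unset Strict Implicit.
Unset Printing Implicit Defensive.

Import Order.TTheory GRing.Theory Num.Theory.
Import numFieldNormedType.Exports.

Local Open Scope classical_set_scope.
Local Open Scope ring_scope.

Section charge_variation_measure.
Context (R : realType) (nu : {charge set (measurableTypeR R) -> \bar R}).

(* The values below do not depend on which Hahn decomposition is chosen, see
   [Hahn_decomposition_uniq]. *)
Let P := projT1 (cid (Hahn_decomposition nu)).
Let N := projT1 (cid (projT2 (cid (Hahn_decomposition nu)))).
Let nuPN : hahn_decomposition nu P N :=
  projT2 (cid (projT2 (cid (Hahn_decomposition nu)))).

Definition variation : {measure set (measurableTypeR R) -> \bar R} :=
  charge_variation nuPN.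

Definition charge_integral (f : R -> R) : R :=
  (\int[jordan_pos nuPN]_x f x - \int[jordan_neg nuPN]_x f x)%R.

End charge_variation_measure.

Section BV_interval.
Context (R : realType) (a b : R).

Local Notation leb := (@lebesgue_measure R).
Local Notation Omega := (`]a, b[%classic : set R).

(* C_c^oo(]a, b[), each function being extended by zero to the real line. *)
Definition test_function (phi : R -> R) : Prop :=
  [/\ forall (n : nat) (x : R), derivable (derive1n n phi) x 1,
      compact (closure [set x | phi x != 0]) &
      closure [set x | phi x != 0] `<=` Omega].

(* A finite signed measure on ]a, b[ is represented by a charge on the real
   line that vanishes outside ]a, b[. *)
Definition is_distributional_derivative (u : R -> R)
    (nu : {charge set (measurableTypeR R) -> \bar R}) : Prop :=
  (forall A : set (measurableTypeR R),
     measurable A -> nu A = nu (A `&` Omega)) /\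
  (forall phi : R -> R, test_function phi ->
     \int[leb]_(x in Omega) (u x * derive1 phi x) = - charge_integral nu phi).

(* Elements are representatives: the values outside ]a, b[ and on null sets
   are irrelevant, and equality in BV(]a, b[) is equality almost everywhere
   on ]a, b[. *)
Record BVspace := MkBVspace {
  BV_fun :> R -> R ;
  BV_integrable : leb.-integrable Omega (EFin \o BV_fun) ;
  BV_derivative : exists nu, is_distributional_derivative BV_fun nu }.

HB.instance Definition _ := gen_eqMixin BVspace.
HB.instance Definition _ := gen_choiceMixin BVspace.

Definition distD (u : BVspace) : {charge set (measurableTypeR R) -> \bar R} :=
  projT1 (cid (BV_derivative u)).

Definition energy (alpha : R -> R) (g u : BVspace) : \bar R :=
  ((2^-1)%:E * \int[leb]_(x in Omega) ((g x - u x) ^+ 2)%:E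
   + \int[variation (distD u)]_(x in Omega) (alpha x)%:E)%E.

Definition argmin_energy (alpha : R -> R) (g : BVspace) : set BVspace :=
  [set u | forall v : BVspace, (energy alpha g u <= energy alpha g v)%E].

(* The minimiser is unique only up to equality almost everywhere, so one
   representative is chosen; the default value g is returned only when there is
   no minimiser. *)
Definition argminS (alpha : R -> R) (g : BVspace) : BVspace :=
  xget g (argmin_energy alpha g).

End BV_interval.

(* Main.v *)
(** In one dimension, total variation denoising is the taut string algorithm. Let G and U be the
    primitives of the datum g and of the candidate u that vanish at a. Then u minimises the energy
    as soon as U is the taut string in the tube of radius alpha around G: |U - G| <= alpha, with
    equal end points, U is locally concave where it does not touch the upper wall and locally
    convex where it does not touch the lower wall. Indeed Du is then positive only where
    U - G = alpha and negative only where U - G = - alpha, so that pairing U - G with Du gives the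
    total variation of u, whereas pairing it with Dz gives at most that of z.
    The taut string exists by Perron's method, and it has a BV derivative since it is locally
    convex or concave. If U1 is taut for (G, alpha1) and U2 for (U1, alpha2), then U2 is taut for
    (G, alpha1 + alpha2): where U2 touches U1 + alpha2 with U1 locally concave, U2 - U1 is locally
    convex with an interior maximum, because alpha2 is constant, and so U2 is a translate of U1. *)

From HB Require Import structures.
Require Import Defs.
From mathcomp Require Import all_boot all_order all_algebra.
From mathcomp Require Import all_classical all_reals all_analysis.
From mathcomp Require Import measurable_realfun.
From mathcomp Require Import ring lra.

Import Order.TTheory GRing.Theory Num.Theory.
Import numFieldNormedType.Exports.

Set Implicit Arguments.
Unset Strict Implicit.
Unset Printing Implicit Defensive.

Local Open Scope classical_set_scope.
Local Open Scope ring_scope.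

(** * The double obstacle problem *)

Section obstacle.
Context {R : realType}.
Implicit Types (a b p q m s x t e d M K : R) (U W L H : R -> R).

(** A BV function comes with a charge known only through test functions, whereas the string argument
    needs its values on intervals. The link is that u equals c + Du(]-oo, x]) almost everywhere; it
    follows from the du Bois-Reymond lemma, tested on explicit functions built from exp(-1/q). After
    that, integration by parts is Fubini: for h of mean zero on ]a, b[, the integral of h z is that
    of [tail h] against Dz, and [tail h] is G - U when h = u - g. Contact with the walls is a matter
    of null sets of the Jordan parts of Du: where U is convex, the distribution function of Du is
    nondecreasing, so the negative part is dominated by the positive part, to which it is singular.
    Comparing energies leaves a remainder, E(u) + |u - z|^2 / 2 <= E(z) with the L^2 norm. Hence
    every minimiser equals u almost everywhere, and it does not matter which one [argminS] chooses.
    The datum of the second problem is such a chosen representative, but tautness sees it only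
    through its primitive. *)

Definition cont_on a b U := forall t, a <= t -> t <= b -> forall e, 0 < e ->
  exists2 d : R, 0 < d & forall x, a <= x -> x <= b -> `|x - t| < d ->
    `|U x - U t| < e.

(* Comparison with affine functions replaces "concave wherever W < H" (and, for
   subsolutions, "convex wherever W > L"); unlike these, it passes to infima. *)
Definition supersolution a b H W := forall p q m s, a <= p -> p <= q -> q <= b ->
  (forall x, p <= x -> x <= q -> m + s * x <= H x) ->
  m + s * p <= W p -> m + s * q <= W q ->
  forall x, p <= x -> x <= q -> m + s * x <= W x.

Definition subsolution a b L W := forall p q m s, a <= p -> p <= q -> q <= b ->
  (forall x, p <= x -> x <= q -> L x <= m + s * x) ->
  W p <= m + s * p -> W q <= m + s * q ->
  forall x, p <= x -> x <= q -> W x <= m + s * x.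

Lemma line_le m s m' s' p q x : p <= x -> x <= q ->
  m + s * p <= m' + s' * p -> m + s * q <= m' + s' * q ->
  m + s * x <= m' + s' * x.
Proof.
move=> px xq h1 h2; have [e0|e0] := lerP 0 (s' - s).
  have := mulr_ge0 e0 (_ : 0 <= x - p); rewrite subr_ge0 => /(_ px); lra.
have := mulr_ge0 (_ : 0 <= s - s') (_ : 0 <= q - x).
by rewrite !subr_ge0 => /(_ _ xq) h; have := h ltac:(lra); lra.
Qed.

Lemma supersolution_min a b H W1 W2 : supersolution a b H W1 ->
  supersolution a b H W2 -> supersolution a b H (fun x => Num.min (W1 x) (W2 x)).
Proof.
move=> h1 h2 p q m s ap pq qb hH; rewrite !le_min => /andP[a1 a2] /andP[b1 b2].
by move=> x px xq; rewrite le_min (h1 p q m s) //= (h2 p q m s).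
Qed.

Lemma supersolution_affine a b H m' s' : supersolution a b H (fun x => m' + s' * x).
Proof. by move=> p q m s ap pq qb _ h1 h2 x px xq; exact: line_le px xq h1 h2. Qed.

(** Negation exchanges the two obstacles, so regularity is studied for supersolutions only. *)
Lemma subsolutionN a b L W :
  subsolution a b L W <-> supersolution a b (fun x => - L x) (fun x => - W x).
Proof.
split=> h p q m s ap pq qb hL h1 h2 x px xq.
  have := h p q (- m) (- s) ap pq qb _ _ _ x px xq.
  move=> k; have : W x <= - m + - s * x; last by lra.
  by apply: k => [y py yq||]; [have := hL y py yq|..]; lra.
have := h p q (- m) (- s) ap pq qb _ _ _ x px xq.
move=> k; have : - m + - s * x <= - W x; last by lra.
by apply: k => [y py yq||]; [have := hL y py yq|..]; lra.
Qed.

(** Reduces neighbourhoods on the left of a point to neighbourhoods on its right. *)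
Lemma supersolution_reflect a b H W : supersolution a b H W ->
  supersolution (- b) (- a) (fun x => H (- x)) (fun x => W (- x)).
Proof.
move=> h p q m s ap pq qb hH h1 h2 x px xq.
have -> : m + s * x = m + - s * - x by lra.
apply: (h (- q) (- p)); try lra.
by move=> y py yq; have := hH (- y); rewrite opprK; lra.
Qed.

Lemma cont_onN a b U : cont_on a b U -> cont_on a b (fun x => - U x).
Proof.
move=> h t ha hb e e0; have [d d0 hd] := h t ha hb e e0; exists d => // x hx1 hx2 hx.
by rewrite -opprD normrN; exact: hd.
Qed.

Lemma cont_on_reflect a b U : cont_on a b U -> cont_on (- b) (- a) (fun x => U (- x)).
Proof.
move=> h t ha hb e e0; have [|| d d0 hd] := h (- t) _ _ e e0; try lra.
exists d => // x hx1 hx2 hx; apply: hd; try lra.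
by rewrite -opprD normrN.
Qed.

(** The comparison line starts at height W t - e/2 and falls steeply enough to end below the lower
    bound M at q. Near t it stays below H, because H is continuous and H t >= W t; the supersolution
    property puts W above it. *)
Lemma supersolution_lsc_right a b H W M : cont_on a b H ->
  (forall x, a <= x -> x <= b -> M <= W x /\ W x <= H x) -> supersolution a b H W ->
  forall t, a <= t -> t <= b -> forall e, 0 < e ->
  exists2 d : R, 0 < d & forall x, t <= x -> x <= b -> x < t + d -> W t - e < W x.
Proof.
move=> cH hW sW t at_ tb e e0.
have [d d0 hd] := cH t at_ tb (e / 2) (divr_gt0 e0 (ltr0n _ 2)).
have [tb'|] := ltP t b; last first.
  by move=> bt; exists 1 => // x tx xb _; have -> : x = t; lra.
have [Mt tH] := hW t at_ tb.
pose q := Num.min b (t + d / 2).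
have tq : t < q by rewrite lt_min tb'; lra.
have qb : q <= b by rewrite ge_min lexx.
have qd : q <= t + d / 2 by rewrite ge_min lexx orbT.
pose K := (W t - M) / (q - t).
have K0 : 0 <= K by rewrite divr_ge0; lra.
have Kq : K * (q - t) = W t - M by rewrite mulfVK// gt_eqF// subr_gt0.
(* Within this distance the line falls by less than e/2; K + 1 in place of K covers the case K =
   0. *)
exists (Num.min (q - t) (e / (2 * (K + 1)))).
  by rewrite lt_min subr_gt0 tq divr_gt0//; lra.
move=> x tx xb; rewrite -ltrBlDl lt_min => /andP[xq xe].
have xK : (x - t) * (2 * (K + 1)) < e by rewrite -ltr_pdivlMr//; lra.
have KX : K * (x - t) <= (K + 1) * (x - t) by rewrite ler_wpM2r//; lra.
suff : (W t - e / 2 + K * t) + - K * x <= W x by lra.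
apply: (sW t q) => //; try lra; last by have := (hW q ltac:(lra) qb).1; lra.
move=> y ty yq; have yd : `|y - t| < d by rewrite ger0_norm; lra.
have := hd y ltac:(lra) ltac:(lra) yd; rewrite ltr_norml => /andP[hy _].
have : 0 <= K * (y - t) by rewrite mulr_ge0//; lra.
lra.
Qed.

Lemma supersolution_lsc a b H W M : cont_on a b H ->
  (forall x, a <= x -> x <= b -> M <= W x /\ W x <= H x) -> supersolution a b H W ->
  forall t, a <= t -> t <= b -> forall e, 0 < e ->
  exists2 d : R, 0 < d & forall x, a <= x -> x <= b -> `|x - t| < d -> W t - e < W x.
Proof.
move=> cH hW sW t at_ tb e e0.
have [d1 d10 h1] := supersolution_lsc_right cH hW sW at_ tb e0.
have [|||d2 d20 h2] := @supersolution_lsc_right (- b) (- a) _ _ M (cont_on_reflect cH)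
  _ (supersolution_reflect sW) (- t) _ _ e e0; try lra.
  by move=> x hx1 hx2; apply: hW; lra.
exists (Num.min d1 d2); first by rewrite lt_min d10.
move=> x ax xb; rewrite lt_min !ltr_norml => /andP[/andP[k1 k2] /andP[k3 k4]].
have [tx|xt] := leP t x; first by apply: h1 => //; lra.
by have := h2 (- x); rewrite !opprK; apply; lra.
Qed.

(** Lower semicontinuity of U, as a supersolution, and of - U, as the negative of a subsolution. *)
Lemma double_obstacle_cont a b L H U M M' : cont_on a b L -> cont_on a b H ->
  (forall x, a <= x -> x <= b -> [/\ M <= L x, L x <= U x, U x <= H x & H x <= M']) ->
  supersolution a b H U -> subsolution a b L U -> cont_on a b U.
Proof.
move=> cL cH hU sup /subsolutionN sub t at_ tb e e0.
have [|d1 d10 h1] := @supersolution_lsc a b H U M cH _ sup t at_ tb e e0.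
  by move=> x ax xb; have [] := hU x ax xb; split; lra.
have [|d2 d20 h2] := @supersolution_lsc a b _ _ (- M') (cont_onN cL) _ sub t at_ tb e e0.
  by move=> x ax xb; have [] := hU x ax xb; split; lra.
exists (Num.min d1 d2); first by rewrite lt_min d10.
move=> x ax xb; rewrite lt_min => /andP[k1 k2]; rewrite ltr_norml.
by have := h1 x ax xb k1; have := h2 x ax xb k2; lra.
Qed.

End obstacle.

(** * Existence for the double obstacle problem *)

Section obstacle_existence.
Context {R : realType}.
Implicit Types (a b p q m s x t e d M K A B : R) (U W L H : R -> R).

(** Within d of a, continuity keeps L below A; farther away the slope |M - A| / d has lifted the
    line above the bound M. The slope |B - A| / (b - a) serves the value at b. Cut off by H, such a
    line is a competitor that forces the Perron solution down to A at a. *)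
Lemma affine_barrier a b L A B M : a < b -> cont_on a b L ->
  (forall x, a <= x -> x <= b -> L x <= M) -> L a < A ->
  exists K, (forall x, a <= x -> x <= b -> L x <= A + K * (x - a)) /\
    B <= A + K * (b - a).
Proof.
move=> ab cL LM LA.
have [d d0 hd] := cL a (lexx a) (ltW ab) (A - L a) ltac:(lra).
pose K1 := `|M - A| / d; pose K2 := `|B - A| / (b - a).
have K10 : 0 <= K1 by rewrite divr_ge0// ltW.
have K20 : 0 <= K2 by rewrite divr_ge0// subr_ge0 ltW.
have K1d : K1 * d = `|M - A| by rewrite mulfVK// gt_eqF.
have K2d : K2 * (b - a) = `|B - A| by rewrite mulfVK// gt_eqF// subr_gt0.
have nM := ler_norm (M - A); have nB := ler_norm (B - A).
exists (K1 + K2); split.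
  move=> x ax xb; have [xd|dx] := ltP (x - a) d.
    have := hd x ax xb; rewrite ger0_norm ?subr_ge0// => /(_ xd).
    rewrite ltr_norml => /andP[_ h].
    have : 0 <= (K1 + K2) * (x - a) by rewrite mulr_ge0//; lra.
    lra.
  have : K1 * d <= (K1 + K2) * (x - a) by rewrite ler_pM//; lra.
  by have := LM x ax xb; lra.
have : K2 * (b - a) <= (K1 + K2) * (b - a) by rewrite ler_wpM2r; lra.
lra.
Qed.

(* Perron's method: U is the least supersolution above L with boundary values at least A and B. *)
Lemma double_obstacle_exists a b L H A B M M' : a < b -> cont_on a b L ->
  (forall x, a <= x -> x <= b -> [/\ M <= L x, L x <= H x & H x <= M']) ->
  L a < A -> A <= H a -> L b < B -> B <= H b ->
  exists U, [/\ U a = A, U b = B, forall x, a <= x -> x <= b -> L x <= U x /\ U x <= H x,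
     supersolution a b H U & subsolution a b L U].
Proof.
move=> ab cL LH LA AH LB BH.
pose adm W := [/\ supersolution a b H W, forall x, a <= x -> x <= b -> L x <= W x,
  A <= W a & B <= W b].
have admH : adm H.
  split=> // [p q m s _ _ _ h _ _|x ax xb]; first exact: h.
  by have [] := LH x ax xb.
pose E x := [set y | exists2 W, adm W & y = W x].
pose U x := inf (E x).
have E0 x : E x !=set0 by exists (H x); exists H.
have UleW W x : adm W -> a <= x -> x <= b -> U x <= W x.
  move=> aW ax xb; apply: ge_inf; last by exists W.
  by exists (L x) => _ [V [_ hV _ _] ->]; exact: hV.
have leU c x : (forall W, adm W -> c <= W x) -> c <= U x.
  by move=> h; apply: lb_le_inf => // _ [V aV ->]; exact: h.
have supU : supersolution a b H U.
  move=> p q m s ap pq qb hH hp hq x px xq; apply: leU => W aW.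
  have [sW _ _ _] := aW; apply: (sW p q) => //.
    by apply: le_trans hp _; apply: UleW => //; lra.
  by apply: le_trans hq _; apply: UleW => //; lra.
have LU x : a <= x -> x <= b -> L x <= U x.
  by move=> ax xb; apply: leU => W [_ h _ _]; exact: h.
have bar m s : (forall x, a <= x -> x <= b -> L x <= m + s * x) ->
    A <= m + s * a -> B <= m + s * b -> adm (fun x => Num.min (H x) (m + s * x)).
  move=> h hA hB; split.
  - by apply: supersolution_min; [move=> p q ? ? ? ? ? h' ? ?; exact: h'|exact: supersolution_affine].
  - by move=> x ax xb; rewrite le_min h//; have [_ ->] := LH x ax xb.
  - by rewrite le_min AH.
  - by rewrite le_min BH.
have Ua : U a = A.
  apply/eqP; rewrite eq_le; apply/andP; split; last by apply: leU => W [].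
  have [K [hK hB]] := @affine_barrier a b L A B M' ab cL
    (fun x ax xb => let: And3 _ h1 h2 := LH x ax xb in le_trans h1 h2) LA.
  have aW : adm (fun x => Num.min (H x) ((A - K * a) + K * x)).
    apply: bar; try lra.
    by move=> x ax xb; have := hK x ax xb; lra.
  apply: le_trans (UleW _ _ aW _ _) _; try lra.
  by rewrite ge_min; apply/orP; right; lra.
have Ub : U b = B.
  apply/eqP; rewrite eq_le; apply/andP; split; last by apply: leU => W [].
  have [||||K [hK hB]] := @affine_barrier (- b) (- a) (fun x => L (- x)) B A M'.
  - lra.
  - exact: cont_on_reflect.
  - by move=> x ax xb; have [] := LH (- x) ltac:(lra) ltac:(lra); lra.
  - by rewrite opprK.
  have aW : adm (fun x => Num.min (H x) ((B + K * b) + - K * x)).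
    apply: bar; try lra.
    by move=> x ax xb; have := hK (- x) ltac:(lra) ltac:(lra); rewrite opprK; lra.
  apply: le_trans (UleW _ _ aW _ _) _; try lra.
  by rewrite ge_min; apply/orP; right; lra.
exists U; split => //.
  by move=> x ax xb; split; [exact: LU|exact: UleW].
move=> p q m s ap pq qb hL hp hq.
(* Cutting U by the line above [p, q] keeps it admissible. *)
pose W x := if (p <= x) && (x <= q) then Num.min (U x) (m + s * x) else U x.
have WU x : W x <= U x by rewrite /W; case: ifP => // _; rewrite ge_min lexx.
have Wl x : p <= x -> x <= q -> W x <= m + s * x.
  by move=> px xq; rewrite /W px xq /= ge_min lexx orbT.
have Wp x c : c <= U x -> (p <= x -> x <= q -> c <= m + s * x) -> c <= W x.
  by move=> h1 h2; rewrite /W; case: ifP => // /andP[px xq]; rewrite le_min h1 h2.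
suff aW : adm W.
  move=> x px xq; apply: le_trans (UleW _ _ aW _ _) (Wl _ px xq); lra.
split.
(* On the overlap of [r, r'] with [p, q] the test line lies below the cutting line because it does
   so at both ends of the overlap: at r or r' because W does, at p or q because U does. *)
- move=> r r' m' s' ar rr' r'b h hr hr' x rx xr'; apply: Wp.
    by apply: (supU r r') => //; [exact: le_trans hr _|exact: le_trans hr' _].
  move=> px xq; apply: (@line_le _ _ _ _ _ (Num.max r p) (Num.min r' q)).
  + by rewrite ge_max rx.
  + by rewrite le_min xr'.
  + have [rp|pr] := leP r p; last by apply: le_trans hr (Wl _ _ _); lra.
    apply: le_trans hp; apply: (supU r r') => //; try lra.
      exact: le_trans hr _.
    exact: le_trans hr' _.
  + have [rp|pr] := leP r' q; first by apply: le_trans hr' (Wl _ _ _); lra.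
    apply: le_trans hq; apply: (supU r r') => //; try lra.
      exact: le_trans hr _.
    exact: le_trans hr' _.
- by move=> x ax xb; apply: Wp; [exact: LU|exact: hL].
- apply: Wp; first by rewrite Ua.
  move=> pa aq; have pe : p = a by lra.
  by rewrite -Ua -pe.
- apply: Wp; first by rewrite Ub.
  move=> pb bq; have qe : q = b by lra.
  by rewrite -Ub -qe.
Qed.

End obstacle_existence.

(** * Taut strings *)

Section taut_strings.
Context {R : realType}.
Implicit Types (a b p q m s x t e d M K A B : R) (U W L H G al : R -> R).

(** Slopes of consecutive chords increase. Cross-multiplication keeps the condition linear in U. *)
Definition cvx_on p q U := forall x y z : R, p <= x -> x < y -> y < z -> z <= q ->
  (U y - U x) * (z - y) <= (U z - U y) * (y - x).

(** The neighbourhood is relative to [a, b], so that t may be an end point. *)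
Definition locally_cvx a b U t := exists2 e : R, 0 < e &
  forall p q, a <= p -> t - e <= p -> q <= b -> q <= t + e -> cvx_on p q U.

(* U is the shortest string from (a, G a) to (b, G b) inside the tube |U - G| <= al:
   it bends down only where it touches the lower wall, up only where it touches the upper one. *)
Definition taut a b al G U := [/\ cont_on a b U, U a = G a, U b = G b &
  forall t, a <= t -> t <= b -> [/\ `|U t - G t| <= al t,
    U t - G t < al t -> locally_cvx a b (fun x => - U x) t &
    - al t < U t - G t -> locally_cvx a b U t] ].

(** Compactness of [a, b] as an induction: the local hypothesis at the supremum of the r with P a r
    pushes this supremum up to b. *)
Lemma interval_induction a b (P : R -> R -> Prop) : a <= b ->
  (forall l m r : R, l <= m -> m <= r -> P l m -> P m r -> P l r) ->
  (forall t, a <= t -> t <= b -> exists2 e : R, 0 < e & forall l r : R, a <= l ->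
    l <= r -> r <= b -> t - e <= l -> r <= t + e -> P l r) -> P a b.
Proof.
move=> ab glue loc.
pose S := [set r : R | [/\ a <= r, r <= b & P a r]].
have Sa : S a.
  have [e e0 he] := loc a (lexx a) ab.
  by split => //; apply: he => //; lra.
have hS : has_sup S by split; [exists a|exists b => r []].
have aS : a <= sup S by apply: ub_le_sup => //; case: hS.
have Sb : sup S <= b by apply: ge_sup; [exists a|move=> r []].
have [e e0 he] := loc _ aS Sb.
have [r [ar rb Par] hr] := sup_adherent e0 hS.
have rS : r <= sup S by apply: ub_le_sup => //; case: hS.
pose c := Num.min b (sup S + e).
have cb : c <= b by rewrite ge_min lexx.
have ce : c <= sup S + e by rewrite ge_min lexx orbT.
have Sc : sup S <= c by rewrite le_min Sb; lra.
have Pac : P a c by apply: (glue _ r) => //; [lra|apply: he => //; lra].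
have cS : c <= sup S by apply: ub_le_sup => //; [case: hS|split => //; lra].
suff <- : c = b by [].
apply/eqP; rewrite eq_le cb /= le_min lexx /=.
have := le_trans cS Sb; have : ~~ (sup S + e <= sup S) by rewrite -ltNge; lra.
move=> h _; have : (b <= sup S) || (sup S + e <= sup S) by rewrite -ge_min.
by rewrite (negbTE h) orbF; lra.
Qed.

Lemma cont_on_bounded a b U : a <= b -> cont_on a b U ->
  exists M, forall x, a <= x -> x <= b -> `|U x| <= M.
Proof.
move=> ab cU.
apply: (@interval_induction a b (fun l r => exists M, forall x, l <= x -> x <= r -> `|U x| <= M)) => //.
  move=> l m r _ _ [M1 h1] [M2 h2]; exists (Num.max M1 M2) => x lx xr.
  by rewrite le_max; have [xm|mx] := leP x m; [rewrite h1|rewrite h2 ?orbT// ltW].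
move=> t at_ tb; have [d d0 hd] := cU t at_ tb 1 ltr01; exists (d / 2); first lra.
move=> l r al lr rb tl rt; exists (`|U t| + 1) => x lx xr.
have := hd x ltac:(lra) ltac:(lra); rewrite ltr_norml => /(_ ltac:(apply/andP; lra)).
have := ler_distD (U t) (U x) 0; rewrite !subr0; lra.
Qed.

(** Since U stays above c and L below it, every chord of U lies above L. It is therefore an allowed
    comparison line, and U lies below it. *)
Lemma subsolution_cvx a b L U c p q : subsolution a b L U -> a <= p -> q <= b ->
  (forall x, p <= x -> x <= q -> L x <= c /\ c <= U x) -> cvx_on p q U.
Proof.
move=> sU ap qb hc x y z px xy yz zq.
pose s := (U z - U x) / (z - x).
have sE : s * (z - x) = U z - U x by rewrite mulfVK// gt_eqF//; lra.
have hy : U y <= (U x - s * x) + s * y.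
  apply: (sU x z) => //; try lra.
  move=> w xw wz; apply: le_trans (hc w _ _).1 _; try lra.
  have -> : c = c + 0 * w by lra.
  by apply: (line_le xw wz); have := (hc x ltac:(lra) ltac:(lra)).2;
    have := (hc z ltac:(lra) ltac:(lra)).2; lra.
have : (U y - U x) * (z - x) <= s * (y - x) * (z - x) by rewrite ler_wpM2r; lra.
by rewrite mulrAC sE; lra.
Qed.

(** By continuity, the midpoint of L t and U t separates the two functions near t. *)
Lemma double_obstacle_cvx a b L U t : cont_on a b L -> cont_on a b U ->
  subsolution a b L U -> a <= t -> t <= b -> L t < U t -> locally_cvx a b U t.
Proof.
move=> cL cU sU at_ tb LU.
have h0 : 0 < (U t - L t) / 2 by lra.
have [d1 d10 h1] := cL t at_ tb _ h0; have [d2 d20 h2] := cU t at_ tb _ h0.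
exists (Num.min d1 d2 / 2); first by rewrite divr_gt0// lt_min d10.
set d := Num.min d1 d2.
have dd1 : d <= d1 by rewrite ge_min lexx.
have dd2 : d <= d2 by rewrite ge_min lexx orbT.
have d0 : 0 < d by rewrite lt_min d10.
move=> p q ap tp qb qt; apply: (@subsolution_cvx a b L U ((L t + U t) / 2)) => // x px xq.
have xd : `|x - t| < d by rewrite ltr_norml; apply/andP; lra.
have := h1 x ltac:(lra) ltac:(lra) (lt_le_trans xd dd1).
have := h2 x ltac:(lra) ltac:(lra) (lt_le_trans xd dd2).
by rewrite !ltr_norml => /andP[? ?] /andP[? ?]; split; lra.
Qed.

Lemma cont_onD a b U W : cont_on a b U -> cont_on a b W ->
  cont_on a b (fun x => U x + W x).
Proof.
move=> cU cW t at_ tb e e0.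
have [d1 d10 h1] := cU t at_ tb (e / 2) ltac:(lra).
have [d2 d20 h2] := cW t at_ tb (e / 2) ltac:(lra).
exists (Num.min d1 d2); first by rewrite lt_min d10.
move=> x ax xb; rewrite lt_min => /andP[/(h1 x ax xb) k1 /(h2 x ax xb) k2].
rewrite opprD addrACA; apply: le_lt_trans (ler_normD _ _) _; lra.
Qed.

(** The obstacles are G - al and G + al. Positivity of al puts the boundary values of G strictly
    above the lower one, which the affine barriers require. *)
Lemma taut_exists a b al G : a < b -> cont_on a b al -> cont_on a b G ->
  (forall x, a <= x -> x <= b -> 0 < al x) -> exists U, taut a b al G U.
Proof.
move=> ab cal cG al0.
have cH := cont_onD cG cal; have cL := cont_onD cG (cont_onN cal).
have [M hM] := cont_on_bounded (ltW ab) cL.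
have [M' hM'] := cont_on_bounded (ltW ab) cH.
have hLH x : a <= x -> x <= b ->
    [/\ - M <= G x + - al x, G x + - al x <= G x + al x & G x + al x <= M'].
  move=> ax xb; have := hM x ax xb; have := hM' x ax xb; have := al0 x ax xb.
  by rewrite !ler_norml => ? /andP[? ?] /andP[? ?]; split; lra.
have [||||U [Ua Ub hU sup sub]] := double_obstacle_exists (A := G a) (B := G b) ab cL hLH.
- by have := al0 a ltac:(lra) ltac:(lra); lra.
- by have := al0 a ltac:(lra) ltac:(lra); lra.
- by have := al0 b ltac:(lra) ltac:(lra); lra.
- by have := al0 b ltac:(lra) ltac:(lra); lra.
have cU : cont_on a b U.
  apply: double_obstacle_cont cL cH _ sup sub => x ax xb.
  have [h1 h2 h3] := hLH x ax xb; have [h4 h5] := hU x ax xb.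
  by split; [exact: h1|exact: h4|exact: h5|exact: h3].
exists U; split => // t at_ tb; have [h1 h2] := hU t at_ tb; split.
- by rewrite ler_norml; apply/andP; lra.
- move=> lt1; apply: (double_obstacle_cvx (cont_onN cH) (cont_onN cU)) => //; last lra.
  apply/subsolutionN => p q m s ap pq qb hH hp hq x px xq; rewrite opprK.
  apply: (sup p q m s) => //; [|by rewrite opprK in hp|by rewrite opprK in hq].
  by move=> y py yq; have := hH y py yq; rewrite opprK.
- by move=> lt1; apply: (double_obstacle_cvx cL cU) => //; lra.
Qed.

Lemma tautN a b al G U : taut a b al G U -> taut a b al (fun x => - G x) (fun x => - U x).
Proof.
move=> [cU Ua Ub h]; split; [exact: cont_onN|by rewrite Ua|by rewrite Ub|].
have UNN : (fun x => - - U x) = U by apply/funext => x; rewrite opprK.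
move=> t at_ tb; have [h1 h2 h3] := h t at_ tb; split.
- by rewrite -opprD normrN.
- by move=> lt1; rewrite UNN; apply: h3; lra.
- by move=> lt1; apply: h2; lra.
Qed.

(** A value below M at x would force, by convexity about t, a value above M at the mirror point 2 t
    - x. *)
Lemma cvx_max_cst t e M U : cvx_on (t - e) (t + e) U ->
  (forall x, t - e <= x -> x <= t + e -> U x <= M) -> U t = M ->
  forall x, t - e <= x -> x <= t + e -> U x = M.
Proof.
move=> cU leM Ut.
have refl x : t - e <= x -> x <= t + e -> t - e <= 2 * t - x <= t + e.
  by move=> h1 h2; apply/andP; lra.
move=> x tx xt; have Ux := leM x tx xt.
have /andP[ty yt] := refl x tx xt; have Uy := leM _ ty yt.
have [xt'|tx'|->] := ltgtP x t; last exact: Ut.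
- have e1 : 2 * t - x - t = t - x by lra.
  have ty' : t < 2 * t - x by lra.
  have := cU x t (2 * t - x) tx xt' ty' yt.
  by rewrite e1 ler_pM2r ?subr_gt0// Ut; lra.
- have e1 : t - (2 * t - x) = x - t by lra.
  have yt' : 2 * t - x < t by lra.
  have := cU (2 * t - x) t x ty yt' tx' xt.
  by rewrite e1 ler_pM2r ?subr_gt0// Ut; lra.
Qed.

Lemma cvx_onD p q U W : cvx_on p q U -> cvx_on p q W -> cvx_on p q (fun x => U x + W x).
Proof.
move=> cU cW x y z px xy yz zq.
have := lerD (cU x y z px xy yz zq) (cW x y z px xy yz zq); lra.
Qed.

(* If U2 touches the upper obstacle U1 + al2 where U1 is concave, then the convex function
   U2 - U1 has an interior maximum, hence is locally constant. *)
Lemma taut_trans_concave a b al1 (al2 : R) G U1 U2 t : 0 < al2 -> taut a b al1 G U1 ->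
  taut a b (fun=> al2) U1 U2 -> a <= t -> t <= b -> U2 t - G t < al1 t + al2 ->
  locally_cvx a b (fun x => - U2 x) t.
Proof.
move=> al20 [_ U1a U1b h1] [_ U2a U2b h2] at_ tb lt12.
have [k1 k2 k3] := h2 t at_ tb; have [l1 l2 l3] := h1 t at_ tb.
have [|ge2] := ltP (U2 t - U1 t) al2; first exact: k2.
(* U2 touches U1 + al2 but stays below G + al1 + al2, so U1 is off its own upper wall and locally
   concave. U2 is off its lower wall because al2 > 0. *)
have [e1 e10 c1] := l2 ltac:(lra); have [e2 e20 c2] := k3 ltac:(lra).
have Dt : U2 t - U1 t = al2 by apply/le_anti; rewrite ge2 (le_trans (ler_norm _)).
(* At the end points U2 = U1, whereas U2 - U1 is al2 > 0 at t; hence t is interior. *)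
have at' : a < t.
  by rewrite lt_neqAle at_ andbT; apply/eqP => ta; move: Dt; rewrite -ta U2a; lra.
have tb' : t < b.
  by rewrite lt_neqAle tb andbT; apply/eqP => ta; move: Dt; rewrite ta U2b; lra.
pose e := Num.min (Num.min e1 e2) (Num.min (t - a) (b - t)).
have e0 : 0 < e by rewrite !lt_min e10 e20 !subr_gt0 at' tb'.
have [ee1 ee2 eat ebt] : [/\ e <= e1, e <= e2, e <= t - a & e <= b - t].
  by split; rewrite !ge_min lexx ?orbT.
clearbody e.
have [r1 r2 r3 r4] : [/\ a <= t - e, t - e1 <= t - e, t - e2 <= t - e & t + e <= b].
  by split; [lra|lra|lra|lra].
have [r5 r6] : t + e <= t + e1 /\ t + e <= t + e2 by split; lra.
have Dge := cvx_max_cst (cvx_onD (c2 _ _ r1 r3 r4 r6) (c1 _ _ r1 r2 r4 r5)) _ Dt.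
exists e => // p q ap tp qb qt x y z px xy yz zq.
have k := c1 p q ap (le_trans r2 tp) qb (le_trans qt r5) x y z px xy yz zq.
have {Dge}E w : p <= w -> w <= q -> - U2 w = - U1 w - al2.
  move=> pw wq; have <- := Dge _ w; first by rewrite opprB addKr.
  - move=> v tv vt; apply: le_trans (ler_norm _) _.
    by have [|+ _ _] := h2 v (le_trans r1 tv); first exact: le_trans vt _.
  - exact: le_trans tp _.
  - exact: le_trans wq _.
rewrite (E x) ?(E y) ?(E z)//; first by lra.
- exact: le_trans px (le_trans (ltW xy) (ltW yz)).
- exact: le_trans px (ltW xy).
- exact: le_trans (ltW yz) zq.
- exact: le_trans (ltW xy) (le_trans (ltW yz) zq).
Qed.

Lemma taut_trans a b al1 (al2 : R) G U1 U2 : 0 < al2 -> taut a b al1 G U1 ->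
  taut a b (fun=> al2) U1 U2 -> taut a b (fun x => al1 x + al2) G U2.
Proof.
move=> al20 t1 t2; have [[_ U1a U1b h1] [cU2 U2a U2b h2]] := (t1, t2).
split => //; [by rewrite U2a|by rewrite U2b|].
move=> t at_ tb; have [k1 _ _] := h2 t at_ tb; have [l1 _ _] := h1 t at_ tb.
split.
- have h := lerD l1 k1; apply: le_trans h.
  by rewrite [leRHS]addrC ler_distD.
- exact: (taut_trans_concave al20 t1 t2 at_ tb).
- move=> lt1.
  have := taut_trans_concave al20 (tautN t1) (tautN t2) at_ tb.
  have -> : (fun x => - - U2 x) = U2 by apply/funext => x; rewrite opprK.
  by apply; rewrite -opprD ltrNl.
Qed.

End taut_strings.

(** * Derivatives of locally convex or concave functions *)

Section density.
Context {R : realType}.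
Implicit Types (a b p q m s x y t e d l r c : R) (U W A B al G : R -> R).

Definition rc_nondecreasing A := {homo A : x y / x <= y} /\
  forall t e, 0 < e -> exists2 d : R, 0 < d & forall x, t <= x -> x < t + d -> A x < A t + e.

(* W is a primitive of A - B: summing this estimate over fine partitions gives
   W y - W x = \int_x^y (A - B). *)
Definition density l r W A B := forall x y, l <= x -> x <= y -> y <= r ->
  `|W y - W x - (A x - B x) * (y - x)| <= ((A y - A x) + (B y - B x)) * (y - x).

Definition has_density W l r := exists A B,
  [/\ rc_nondecreasing A, rc_nondecreasing B & density l r W A B].

Lemma rc_nondecreasing_cst c : rc_nondecreasing (fun=> c).
Proof. by split=> // t e e0; exists 1 => // x _ _; rewrite ltrDl. Qed.

Lemma rc_nondecreasing_glue A1 A2 m : rc_nondecreasing A1 -> rc_nondecreasing A2 ->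
  A1 m <= A2 m -> rc_nondecreasing (fun t => if t < m then A1 t else A2 t).
Proof.
move=> [n1 r1] [n2 r2] h; split.
  move=> x y xy; case: (ltP x m) => xm; case: (ltP y m) => ym.
  - exact: n1.
  - by apply: le_trans (n1 _ _ (ltW xm)) _; apply: le_trans h (n2 _ _ ym).
  - lra.
  - exact: n2.
move=> t e e0; case: (ltP t m) => tm.
  have [d d0 hd] := r1 t e e0; exists (Num.min d (m - t)); first by rewrite lt_min d0 subr_gt0.
  move=> x tx; rewrite -ltrBlDl lt_min => /andP[xd xm].
  have -> : x < m by lra.
  by apply: hd => //; lra.
have [d d0 hd] := r2 t e e0; exists d => // x tx xd.
have -> : (x < m) = false by apply/negbTE; rewrite -leNgt (le_trans tm tx).
exact: hd.
Qed.

Lemma rc_nondecreasingDr A c : rc_nondecreasing A -> rc_nondecreasing (fun t => A t + c).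
Proof.
move=> [nA rA]; split=> [x y xy|t e e0]; first by rewrite lerD2r nA.
have [d d0 hd] := rA t e e0; exists d => // x tx xd.
by rewrite addrAC ltrD2r hd.
Qed.

Lemma densityN l r W A B : density l r W A B -> density l r (fun x => - W x) B A.
Proof.
move=> h x y lx xy yr; rewrite -normrN [X in _ <= X * _]addrC.
by have := h x y lx xy yr; congr (`|_| <= _); lra.
Qed.

(** When x < m <= y the increment of W is split at m. Keeping the density at x beyond m costs at
    most the increments of A and B from x to m, jump at m included. *)
Lemma density_glue W l m r A1 B1 A2 B2 : l <= m -> m <= r ->
  {homo A1 : x y / x <= y} -> {homo B1 : x y / x <= y} ->
  {homo A2 : x y / x <= y} -> {homo B2 : x y / x <= y} ->
  A1 m <= A2 m -> B1 m <= B2 m ->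
  density l m W A1 B1 -> density m r W A2 B2 ->
  density l r W (fun t => if t < m then A1 t else A2 t) (fun t => if t < m then B1 t else B2 t).
Proof.
move=> lm mr nA1 nB1 nA2 nB2 hA hB h1 h2 x y lx xy yr.
case: (ltP x m) => xm; case: (ltP y m) => ym; [|clear xy|lra|].
- exact: h1 (ltW ym).
- have k1 := h1 x m lx (ltW xm) (lexx _); have k2 := h2 m y (lexx _) ym yr.
  have a1 := nA1 _ _ (ltW xm); have b1 := nB1 _ _ (ltW xm).
  have a2 := nA2 _ _ ym; have b2 := nB2 _ _ ym.
  have k3 : `|(A2 m - B2 m - (A1 x - B1 x)) * (y - m)| <=
      ((A2 m - A1 x) + (B2 m - B1 x)) * (y - m).
    rewrite normrM [X in _ * X]ger0_norm ?subr_ge0// ler_wpM2r ?subr_ge0//.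
    by rewrite ler_norml; apply/andP; lra.
  have -> : W y - W x - (A1 x - B1 x) * (y - x) =
    (W m - W x - (A1 x - B1 x) * (m - x)) + (W y - W m - (A2 m - B2 m) * (y - m)) +
    (A2 m - B2 m - (A1 x - B1 x)) * (y - m) by lra.
  apply: le_trans (ler_normD _ _) _; apply: le_trans (lerD (ler_normD _ _) (lexx _)) _.
  apply: le_trans (lerD (lerD k1 k2) k3) _.
  have j1 : (A1 m - A1 x + (B1 m - B1 x)) * (m - x) <= (A2 y - A1 x + (B2 y - B1 x)) * (m - x).
    by rewrite ler_wpM2r; lra.
  lra.
- exact: h2.
Qed.

Lemma has_density_glue W l m r : l <= m -> m <= r -> has_density W l m ->
  has_density W m r -> has_density W l r.
Proof.
move=> lm mr [A1 [B1 [rA1 rB1 h1]]] [A2 [B2 [rA2 rB2 h2]]].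
(* Adding one constant to both A2 and B2 leaves their difference unchanged and makes both jumps at m
   nonnegative. *)
pose c := Num.max (A1 m - A2 m) (B1 m - B2 m).
have cA : A1 m <= A2 m + c by rewrite -lerBlDl le_max lexx.
have cB : B1 m <= B2 m + c by rewrite -lerBlDl le_max lexx orbT.
have rA := rc_nondecreasingDr c rA2; have rB := rc_nondecreasingDr c rB2.
do 2 eexists; split; last first.
- apply: density_glue lm mr rA1.1 rB1.1 rA.1 rB.1 cA cB h1 _ => x y mx xy yr /=.
  by have := h2 x y mx xy yr; congr (`|_| <= _); lra.
- exact: rc_nondecreasing_glue.
- exact: rc_nondecreasing_glue.
Qed.

Lemma has_densityN W l r : has_density (fun x => - W x) l r -> has_density W l r.
Proof.
move=> [A [B [rA rB h]]]; exists B, A; split => //.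
by have := densityN h; congr density; apply/funext => x; rewrite opprK.
Qed.

Lemma has_density_affine W l r s :
  (forall x y, l <= x -> x <= y -> y <= r -> W y - W x = s * (y - x)) -> has_density W l r.
Proof.
move=> h; exists (fun=> s), (fun=> 0); split; [exact: rc_nondecreasing_cst..|].
by move=> x y lx xy yr; rewrite h// subr0 !subrr normr0 addr0 mul0r.
Qed.

(** The density is the right derivative, taken as the infimum [n t] of the slopes to the right.
    Keeping [l, r] strictly inside [p, q] provides a slope on either side to bound it; [cl] clamps
    the argument to [l, r] and so extends it to the line. Right continuity: for a fixed s that
    nearly attains the infimum at t, [slope x s] is continuous in x. *)
Lemma cvx_has_density a b p q l r W : cont_on a b W -> a <= p -> q <= b ->
  p < l -> l <= r -> r < q -> cvx_on p q W -> has_density W l r.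
Proof.
move=> cW ap qb pl lr rq cv.
pose slope x y := (W y - W x) / (y - x).
have slopeE x y : x < y -> slope x y * (y - x) = W y - W x.
  by move=> xy; rewrite mulfVK// gt_eqF// subr_gt0.
have slope_le x y z : p <= x -> x < y -> y < z -> z <= q -> slope x y <= slope y z.
  move=> px xy yz zq; rewrite ler_pdivrMr ?subr_gt0// mulrAC ler_pdivlMr ?subr_gt0//.
  exact: cv.
pose S t := [set slope t s | s in [set s | t < s /\ s <= q]].
pose n t := inf (S t).
have n_le t s : p < t -> t < s -> s <= q -> n t <= slope t s.
  move=> pt ts sq; apply: ge_inf; last by exists s.
  by exists (slope p t) => _ [z [tz zq] <-]; exact: slope_le.
have n_ge x t : p <= x -> x < t -> t < q -> slope x t <= n t.
  move=> px xt tq; apply: lb_le_inf; first by exists (slope t q), q.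
  by move=> _ [z [tz zq] <-]; exact: slope_le.
have n_nd x y : p < x -> x <= y -> y < q -> n x <= n y.
  move=> px; rewrite le_eqVlt => /predU1P[->//|xy] yq.
  by apply: le_trans (n_le x y px xy (ltW yq)) (n_ge x y (ltW px) xy yq).
pose cl t := Num.max l (Num.min r t).
have cll t : l <= cl t by rewrite le_max lexx.
have clr t : cl t <= r by rewrite ge_max lr ge_min lexx.
have cl_nd : {homo cl : x y / x <= y}.
  move=> x y xy; rewrite ge_max cll /= le_max; apply/orP; right.
  by rewrite le_min !ge_min lexx xy orbT.
have cl_id t : l <= t -> t <= r -> cl t = t.
  by move=> lt tr; rewrite /cl (min_idPr tr) (max_idPr lt).
exists (n \o cl), (fun=> 0); split; [split|exact: rc_nondecreasing_cst|].
- move=> x y xy /=; apply: n_nd; [exact: lt_le_trans pl _|exact: cl_nd|exact: le_lt_trans rq].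
- move=> t e e0 /=.
  have [rt|tr] := leP r t.
    exists 1 => // x tx _; have -> : cl x = cl t; last by rewrite ltrDl.
    by rewrite /cl (min_idPl rt) (min_idPl (le_trans rt tx)).
  have [tl|lt] := ltP t l.
    exists (l - t); rewrite ?subr_gt0// => x tx xl.
    have -> : cl x = cl t; last by rewrite ltrDl.
    have xl' : x < l by lra.
    have xr : x <= r by lra.
    by rewrite /cl (min_idPr (ltW tr)) (min_idPr xr) (max_idPl (ltW tl)) (max_idPl (ltW xl')).
  have pt : p < t by exact: lt_le_trans lt.
  have tq : t < q by exact: lt_trans tr rq.
  have hS : has_inf (S t).
    split; first by exists (slope t q), q.
    by exists (slope p t) => _ [z [tz zq] <-]; exact: slope_le.
  have [_ [s [ts sq] <-] hs] := inf_adherent e0 hS.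
  (* [g] is the margin by which the increment of W from t to s stays below that of slope n t + e.
     Half of it is spent on W x - W t, half on c times (x - t). *)
  pose c := n t + e; pose g := c * (s - t) - (W s - W t).
  have g0 : 0 < g by rewrite subr_gt0 -slopeE// ltr_pM2r// subr_gt0.
  have at_ : a <= t by lra.
  have tb : t <= b by lra.
  have [d d0 hd] := cW t at_ tb (g / 2) (divr_gt0 g0 (ltr0n _ 2)).
  have c0 : 0 < 2 * (`|c| + 1) by have := normr_ge0 c; lra.
  exists (Num.min (Num.min d (s - t)) (Num.min (r - t) (g / (2 * (`|c| + 1))))).
    by rewrite !lt_min d0 !subr_gt0 ts tr divr_gt0.
  move=> x tx; rewrite -ltrBlDl !lt_min => /andP[/andP[xd xs] /andP[xr xg]].
  rewrite !cl_id//; [|lra|exact: le_trans tx|lra].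
  have px : p < x by lra.
  have xs' : x < s by lra.
  apply: le_lt_trans (n_le x s px xs' sq) _.
  rewrite /slope ltr_pdivrMr ?subr_gt0// -/c.
  move: xg; rewrite ltr_pdivlMr// => xg.
  have k1 : c * (x - t) <= `|c| * (x - t) by rewrite ler_wpM2r ?ler_norm ?subr_ge0.
  have ax : a <= x by lra.
  have xb : x <= b by lra.
  have := hd x ax xb; rewrite ger0_norm ?subr_ge0// => /(_ xd).
  by rewrite ltr_norml => /andP[k2 _]; rewrite /g in xg k2 *; lra.
- move=> x y lx; rewrite le_eqVlt => /predU1P[->|xy] yr; first by rewrite !subrr mulr0 subr0 normr0 mulr0.
  have xr : x <= r by lra.
  have ly : l <= y by lra.
  rewrite /= !cl_id// !subr0 addr0.
  have k1 := n_le x y (lt_le_trans pl lx) xy ltac:(lra).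
  have k2 := n_ge x y ltac:(lra) xy (le_lt_trans yr rq).
  have yx : 0 <= y - x by rewrite subr_ge0 ltW.
  by rewrite -slopeE// -mulrBl normrM (ger0_norm yx) ler_wpM2r// ger0_norm ?subr_ge0// lerD2r.
Qed.

Lemma cvx_concave_affine p q W : p < q -> cvx_on p q W -> cvx_on p q (fun x => - W x) ->
  forall x y, p <= x -> x <= y -> y <= q -> W y - W x = (W q - W p) / (q - p) * (y - x).
Proof.
move=> pq c1 c2.
have E x y z : p <= x -> x < y -> y < z -> z <= q -> (W y - W x) * (z - y) = (W z - W y) * (y - x).
  by move=> px xy yz zq; have := c1 x y z px xy yz zq; have := c2 x y z px xy yz zq; lra.
have F x : p <= x -> x <= q -> (W x - W p) * (q - p) = (W q - W p) * (x - p).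
  rewrite le_eqVlt => /predU1P[<-|px]; first by rewrite !subrr mul0r mulr0.
  rewrite le_eqVlt => /predU1P[->//|xq].
  by have := E p x q (lexx _) px xq (lexx _); lra.
move=> x y px xy yq.
have := F x px (le_trans xy yq); have := F y (le_trans px xy) yq.
have qp : q - p != 0 by rewrite gt_eqF// subr_gt0.
by move=> h1 h2; rewrite mulrAC; apply: (mulIf qp); rewrite divfK//; lra.
Qed.

(** At an interior point at least one wall is not touched, as al > 0, so U is locally convex or
    concave there. At a and b it touches neither, so it is locally both, hence affine: this keeps
    the slope bounded up to the boundary. *)
Lemma taut_has_density a b al G U : a < b -> (forall x, a <= x -> x <= b -> 0 < al x) ->
  taut a b al G U -> has_density U a b.
Proof.
move=> ab al0 [cU Ua Ub h].
apply: (@interval_induction _ a b (has_density U)); first exact: ltW.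
  by move=> l m r lm mr; exact: has_density_glue.
move=> t at_ tb; have [h1 h2 h3] := h t at_ tb; have alt := al0 t at_ tb.
have [ta|ta] := eqVneq t a.
  have k2 : U t - G t < al t by rewrite ta Ua subrr -ta.
  have k3 : - al t < U t - G t by rewrite ta Ua subrr -ta; lra.
  have [e1 e10 c1] := h2 k2; have [e2 e20 c2] := h3 k3.
  pose e := Num.min (Num.min e1 e2) (b - a).
  have e0 : 0 < e by rewrite !lt_min e10 e20 subr_gt0.
  have [ee1 ee2 eb] : [/\ e <= e1, e <= e2 & e <= b - a].
    by split; rewrite !ge_min lexx ?orbT.
  exists e => // l r al_ lr rb tl rt.
  have aff := cvx_concave_affine (_ : a < a + e)
    (c2 a (a + e) (lexx _) ltac:(lra) ltac:(lra) ltac:(lra))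
    (c1 a (a + e) (lexx _) ltac:(lra) ltac:(lra) ltac:(lra)).
  apply: has_density_affine => x y lx xy yr; apply: aff; lra.
have [tb'|tb'] := eqVneq t b.
  have k2 : U t - G t < al t by rewrite tb' Ub subrr -tb'.
  have k3 : - al t < U t - G t by rewrite tb' Ub subrr -tb'; lra.
  have [e1 e10 c1] := h2 k2; have [e2 e20 c2] := h3 k3.
  pose e := Num.min (Num.min e1 e2) (b - a).
  have e0 : 0 < e by rewrite !lt_min e10 e20 subr_gt0.
  have [ee1 ee2 eb] : [/\ e <= e1, e <= e2 & e <= b - a].
    by split; rewrite !ge_min lexx ?orbT.
  exists e => // l r al_ lr rb tl rt.
  have aff := cvx_concave_affine (_ : b - e < b)
    (c2 (b - e) b ltac:(lra) ltac:(lra) (lexx _) ltac:(lra))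
    (c1 (b - e) b ltac:(lra) ltac:(lra) (lexx _) ltac:(lra)).
  apply: has_density_affine => x y lx xy yr; apply: aff; lra.
have at' : a < t by rewrite lt_neqAle eq_sym ta.
have tb2 : t < b by rewrite lt_neqAle tb'.
have main W : cont_on a b W -> locally_cvx a b W t -> exists2 e : R, 0 < e & forall l r,
    a <= l -> l <= r -> r <= b -> t - e <= l -> r <= t + e -> has_density W l r.
  move=> cW [e1 e10 c1]; pose e := Num.min e1 (Num.min (t - a) (b - t)).
  have e0 : 0 < e by rewrite !lt_min e10 !subr_gt0 at'.
  have [ee1 ea eb] : [/\ e <= e1, e <= t - a & e <= b - t].
    by split; rewrite !ge_min lexx ?orbT.
  (* Half of e, so that [l, r] lies strictly inside the interval of convexity. *)
  exists (e / 2) => [|l r al_ lr rb tl rt]; first lra.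
  apply: (@cvx_has_density a b (t - e) (t + e)) => //; try lra.
  by apply: c1; lra.
have [lt0|ge0] := ltP (U t - G t) (al t).
  have [e e0 he] := main _ (cont_onN cU) (h2 lt0).
  by exists e => // l r *; apply: has_densityN; apply: he.
by apply: main => //; apply: h3; lra.
Qed.

End density.

(** * Distribution functions and integration by parts *)

Section cdf.
Context {R : realType}.
Local Notation T := (measurableTypeR R).
Local Notation leb := (@lebesgue_measure R).
Implicit Types (D : set R) (h : R -> R).

Definition cdf (mu : set T -> \bar R) (t : R) : R := fine (mu `]-oo, t]%classic).

(** The integral of h over the part of D to the right of x. For h of mean zero it is minus the
    primitive of h. *)
Definition tail D h (x : R) : R := \int[leb]_(t in D) (h t * (x <= t)%R%:R).

Lemma cdf_nd (mu : {finite_measure set T -> \bar R}) : {homo cdf mu : x y / x <= y}.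
Proof.
move=> x y xy; apply: fine_le; rewrite ?fin_num_measure//; try exact: measurable_itv.
apply: le_measure; rewrite ?inE//; try exact: measurable_itv.
by apply: subset_itvl; rewrite bnd_simp.
Qed.

Lemma measurable_cdf (mu : {finite_measure set T -> \bar R}) :
  measurable_fun [set: T] (cdf mu).
Proof. by apply: nondecreasing_measurable => //; exact: cdf_nd. Qed.

Lemma integrable_mul_bounded d (S : measurableType d) (mu : {measure set S -> \bar R})
    (D : set S) (h g : S -> R) M : measurable D -> mu.-integrable D (EFin \o h) ->
  measurable_fun D g -> (forall x, D x -> `|g x| <= M) ->
  mu.-integrable D (EFin \o (fun x => h x * g x)).
Proof.
move=> mD ih mg gM.
have mh : measurable_fun D h by apply/measurable_EFinP; exact: measurable_int ih.
have iM : mu.-integrable D (fun x => (`|M| * h x)%:E).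
  by under eq_fun do rewrite EFinM; exact: integrableZl.
apply: le_integrable iM => //.
  by apply/measurable_EFinP; exact: measurable_funM.
move=> x Dx; rewrite /= lee_fin !normrM normr_id mulrC ler_wpM2r//.
by apply: le_trans (gM x Dx) _; exact: ler_norm.
Qed.

Lemma integral_le_indic (mu : {measure set T -> \bar R}) (y : R) :
  (\int[mu]_x (x <= y)%R%:R%:E = mu `]-oo, y]%classic)%E.
Proof.
rewrite -(setIT `]-oo, y]%classic) -integral_indic//.
by apply: eq_integral => x _; rewrite indicE mem_setE in_itv.
Qed.

(** Fubini for h t on the half-plane x <= t: integrating in t first gives [tail], integrating in x
    first gives the mass of ]-oo, t]. Integrability on the product comes from the finite mass of
    mu. *)
Lemma fubini_tail D (mu : {finite_measure set T -> \bar R}) h :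
  measurable D -> leb.-integrable D (EFin \o h) ->
  [/\ mu.-integrable [set: T] (EFin \o tail D h),
      leb.-integrable D (EFin \o (fun t => h t * cdf mu t)) &
      \int[mu]_x tail D h x = \int[leb]_(t in D) (h t * cdf mu t)].
Proof.
move=> mD ih.
have fmu (A : set T) : measurable A -> mu A \is a fin_num by exact: fin_num_measure.
pose F (z : T * T) : \bar R := ((h \_ D) z.2 * (z.1 <= z.2)%R%:R)%:E.
have mh : measurable_fun [set: T] (h \_ D).
  by apply/(measurable_restrictT _ _).1 => //; apply/measurable_EFinP; exact: measurable_int ih.
have ih' : leb.-integrable [set: T] (EFin \o (h \_ D)).
  by rewrite -restrict_EFin; apply/(integrable_mkcond _ _).1.
have mle : measurable_fun [set: T * T] (fun z : T * T => (z.1 <= z.2)%R%:R : R).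
  have -> : (fun z : T * T => (z.1 <= z.2)%R%:R : R) =
      (fun z : T * T => if z.1 <= z.2 then 1 else 0) by apply/funext => z; case: ifP.
  apply: measurable_fun_ifT => //.
  exact: measurable_fun_ler.
have mF : measurable_fun [set: T * T] F.
  apply/measurable_EFinP; apply: measurable_funM => //.
  exact: measurableT_comp mh measurable_snd.
have innerE y : (\int[mu]_x `|F (x, y)| = `|(h \_ D) y|%:E * mu `]-oo, y]%classic)%E.
  rewrite -integral_le_indic -ge0_integralZl_EFin//; last first.
    apply/measurable_EFinP; rewrite (_ : (fun x => _) = \1_(`]-oo, y]%classic)) //.
    by apply/funext => x; rewrite indicE mem_setE in_itv.
  by apply: eq_integral => x _; rewrite /F /= -EFinM normrM (@ger0_norm _ (_%:R)).
have cdfE y : mu `]-oo, y]%classic = (cdf mu y)%:E.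
  by rewrite fineK// fmu//; exact: measurable_itv.
have cdf0 y : 0 <= cdf mu y by exact: fine_ge0.
pose M := fine (mu setT).
have cdfM y : cdf mu y <= M.
  apply: fine_le; rewrite ?fmu//; try exact: measurable_itv.
  by apply: le_measure; rewrite ?inE.
have iF : ((mu \x leb)%E).-integrable setT F.
  apply/(integrable21ltyP _ _ mF).
  under eq_integral do rewrite innerE cdfE -EFinM.
  apply: (@le_lt_trans _ _ (\int[leb]_y (M%:E * `|(h \_ D) y|%:E))%E).
    apply: ge0_le_integral => //.
    - by move=> y _; rewrite lee_fin mulr_ge0.
    - apply/measurable_EFinP; apply: measurable_funM; first exact: measurableT_comp.
      exact: measurable_cdf.
    - by apply/measurable_EFinP; apply: measurable_funM => //; exact: measurableT_comp.
    - by move=> y _; rewrite -EFinM lee_fin mulrC ler_wpM2r.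
  rewrite ge0_integralZl_EFin//; last 2 first.
  - by apply/measurable_EFinP; exact: measurableT_comp.
  - exact: le_trans (cdfM 0).
  rewrite lte_mul_pinfty ?lee_fin//; first exact: le_trans (cdfM 0).
  by have [] := integrableP _ _ _ ih'.
have FE x : (fubini_F leb F x = \int[leb]_(t in D) (h t * (x <= t)%R%:R)%:E)%E.
  rewrite /fubini_F [RHS]integral_mkcond; apply: eq_integral => t _.
  by rewrite /F /= !patchE; case: ifP => //; rewrite mul0r.
have GE y : (fubini_G mu F y = ((h \_ D) y * cdf mu y)%:E)%E.
  rewrite /fubini_G /F /=; under eq_integral do rewrite EFinM.
  rewrite EFinM -cdfE -integral_le_indic integralZl//.
  rewrite (_ : (fun x => _) = EFin \o \1_(`]-oo, y]%classic))//.
    by apply: integrable_indic; exact: measurable_itv.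
  by apply/funext => x; rewrite /= indicE mem_setE in_itv.
have ihc : leb.-integrable D (EFin \o (fun t => h t * cdf mu t)).
  apply: (@integrable_mul_bounded _ _ _ _ _ _ M) => //.
    by apply: (measurable_funS measurableT) => //; exact: measurable_cdf.
  by move=> x _; rewrite ger0_norm.
have iFE := integrable_fubini_F iF.
have tE : EFin \o tail D h = fubini_F leb F.
  apply/funext => x; rewrite FE /= fineK//.
  apply: integrable_fin_num => //.
  apply: (@integrable_mul_bounded _ _ _ _ _ _ 1) => //; last first.
    by move=> t _; case: (x <= t); rewrite ?normr0 ?normr1.
  have -> : (fun t : R => (x <= t)%R%:R : R) = \1_(`[x, +oo[%classic).
    by apply/funext => t; rewrite indicE mem_setE in_itv /= andbT.
  by apply: (measurable_funS measurableT) => //; apply: measurable_indic; exact: measurable_itv.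
split => //; first by rewrite tE.
rewrite /Rintegral; congr fine; rewrite [RHS]integral_mkcond -/(fubini_F leb F).
have -> : (\int[mu]_x (tail D h x)%:E = \int[mu]_x fubini_F leb F x)%E.
  by rewrite -tE.
rewrite (Fubini iF); apply: eq_integral => y _; rewrite -/(fubini_G mu F y) GE.
by rewrite !patchE; case: ifP => //; rewrite mul0r.
Qed.

End cdf.

(** * Smooth test functions *)

Section smooth_functions.
Context {R : realType}.
Implicit Types (f g : R -> R) (p q : {poly R}) (x y t c : R).

(** All derivatives are exhibited together as a sequence, which makes linear combinations and
    antiderivatives immediate. *)
Definition smooth f := exists2 F : nat -> R -> R, F 0%N = f &
  forall n x, is_derive x 1 (F n) (F n.+1 x).

Lemma smooth_derive1n f : smooth f -> forall n x, derivable (derive1n n f) x 1.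
Proof.
move=> [F <- dF].
have E n : derive1n n (F 0%N) = F n.
  elim: n => [//|n IH]; rewrite derive1nS IH; apply/funext => x.
  by rewrite derive1E; have [_ ->] := dF n x.
by move=> n x; rewrite E; have [] := dF n x.
Qed.

Lemma smooth_continuous f : smooth f -> continuous f.
Proof.
move=> [F <- dF] x; apply/differentiable_continuous/derivable1_diffP.
by have [] := dF 0%N x.
Qed.

Lemma smooth_lincomb c d f g : smooth f -> smooth g -> smooth (fun x => c * f x - d * g x).
Proof.
move=> [F <- dF] [G <- dG]; exists (fun n x => c * F n x - d * G n x) => // n x.
by have d1 := dF n x; have d2 := dG n x; exact: is_deriveB.
Qed.

Lemma smooth_antiderivative f g : smooth f -> (forall x, is_derive x 1 g (f x)) -> smooth g.
Proof. by move=> [F <- dF] dg; exists (fun n => if n is m.+1 then F m else g) => // -[|n]. Qed.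

Lemma is_derive_squeeze0 f g t : f t = 0 -> {for t, continuous g} -> g t = 0 ->
  (forall s, `|f s| <= `|s - t| * g s) -> is_derive t 1 f 0.
Proof.
move=> f0 cg g0 fg.
have cv : (fun h : R => h^-1 *: (f (h *: 1 + t) - f t)) @ 0^' --> (0 : R).
  have cgh : (fun h : R => g (h + t)) @ 0^' --> (0 : R).
    rewrite -[X in _ --> X]g0; apply: (@cvg_comp _ _ _ (fun h : R => h + t) g _ (nbhs t)) => //.
    have e : nbhs t = nbhs (0 + t) by rewrite add0r.
    rewrite e; apply: cvgD; last exact: cvg_cst.
    exact: cvg_within.
  apply: norm_cvg0; apply: (squeeze_cvgr _ (cvg_cst 0) cgh).
  near=> h; rewrite normr_ge0 /= f0 subr0 /GRing.scale /= mulr1 normrM normfV.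
  have h0 : 0 < `|h| by rewrite normr_gt0; near: h; exact: nbhs_dnbhs_neq.
  by rewrite mulrC ler_pdivrMr// mulrC; have := fg (h + t); rewrite addrK.
apply: DeriveDef; last exact: cvg_lim.
by apply/cvg_ex; exists 0.
Unshelve. all: by end_near.
Qed.

(** From exp(1/s) >= s^-(k+2) / (k+2)!. Of the k + 2 powers, k absorb the denominator q^k of [bump];
    the two left over give differentiability, with derivative 0, at the zeros of q. *)
Lemma expRNV_le k (s : R) : 0 < s -> expR (- s^-1) <= (k.+2)`!%:R * s ^+ k.+2.
Proof.
move=> s0; rewrite expRN.
have V0 : 0 <= s^-1 by rewrite invr_ge0 ltW.
have F0 : 0 < (k.+2)`!%:R :> R by rewrite ltr0n fact_gt0.
have := expR_ge1Dxn k.+1 V0; rewrite exprVn => h.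
have h' : (s ^+ k.+2)^-1 / (k.+2)`!%:R <= expR s^-1 by lra.
rewrite -[leRHS]invrK lef_pV2 ?posrE ?expR_gt0//.
  by rewrite invfM mulrC.
by rewrite invr_gt0 mulr_gt0// exprn_gt0.
Qed.

(* This family is closed under differentiation, see [is_derive_bump]. *)
Definition bump p q k t := if 0 < q.[t] then p.[t] / q.[t] ^+ k * expR (- (q.[t])^-1) else 0.

(** The numerator collects p', - k p q' / q and p q' / q^2 over the common denominator q^(k+2). This
    is calculus where q > 0 and trivial where q < 0; the zeros of q need the flatness of
    exp(-1/q). *)
Lemma is_derive_bump p q k t : is_derive t 1 (bump p q k)
  (bump (p^`() * q ^+ 2 - k%:R *: (p * q^`() * q) + p * q^`()) q k.+2 t).
Proof.
have [q0|q0|q0] := ltgtP 0 q.[t].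
- have nz : q.[t] != 0 by rewrite gt_eqF.
  have nzk : (q ^+ k).[t] != 0 by rewrite horner_exp expf_neq0.
  have dM := is_deriveM (is_deriveM (is_derive_poly p t) (is_deriveV nzk (is_derive_poly (q ^+ k) t)))
    (is_derive1_comp (is_derive_expR _) (is_deriveN (is_deriveV nz (is_derive_poly q t)))).
  apply: (@near_eq_is_derive _ _ _ (fun s : R => p.[s] * ((q ^+ k).[s])^-1 * expR (- (q.[s])^-1))).
    have : \forall s \near t, 0 < q.[s] by exact: (@cvgr_gt _ _ (nbhs t) _ (horner q) q.[t] (@continuous_horner _ q t) 0 q0).
    by apply: filterS => s; rewrite /bump horner_exp => ->.
  apply: (is_derive_eq dM); rewrite /bump q0 deriv_exp.
  rewrite !(hornerD, hornerN, hornerM, hornerZ, hornerMn, horner_exp) !fctE /GRing.scale /= horner_exp.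
  move: p.[t] q.[t] p^`().[t] q^`().[t] (expR _) nz => P Q P' Q' E nz {nzk q0 dM}.
  case: k => [|k]; first by rewrite !expr0 mulr0n; field.
  rewrite -[_ *+ k.+1]mulr_natr /= !exprS; have nzK : Q ^+ k != 0 by rewrite expf_neq0.
  by move: (Q ^+ k) k.+1%:R nzK => K N nzK; field; rewrite nz nzK.
- have -> : bump (p^`() * q ^+ 2 - k%:R *: (p * q^`() * q) + p * q^`()) q k.+2 t = 0.
    by rewrite /bump ltNge (ltW q0).
  apply: (@near_eq_is_derive _ _ _ (cst 0)).
  have : \forall s \near t, q.[s] < 0 by exact: (@cvgr_lt _ _ (nbhs t) _ (horner q) q.[t] (@continuous_horner _ q t) 0 q0).
  by apply: filterS => s q0'; rewrite /bump ltNge (ltW q0').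
- have -> : bump (p^`() * q ^+ 2 - k%:R *: (p * q^`() * q) + p * q^`()) q k.+2 t = 0.
    by rewrite /bump -q0 ltxx.
  (* Writing q = r (X - t), one of the two spare powers of q provides the factor |s - t| and the
     other tends to 0 at t. *)
  have /factor_theorem[r qE] : root q t by rewrite /root -q0.
  pose C : R := (k.+2)`!%:R; have C0 : 0 <= C by [].
  apply: (@is_derive_squeeze0 _ (fun s => C * `|(p * r * q).[s]|)).
  + by rewrite /bump -q0 ltxx.
  + by apply: cvgM; [exact: cvg_cst|apply: cvg_norm; exact: continuous_horner].
  + by rewrite hornerM -q0 mulr0 normr0 mulr0.
  + move=> s; rewrite /bump; case: ifPn => [qs|_]; last by rewrite normr0 !mulr_ge0.
    rewrite normrM (@ger0_norm _ (expR _)) ?expR_ge0//.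
    apply: le_trans (ler_wpM2l (normr_ge0 _) (expRNV_le k qs)) _.
    have qs0 : 0 <= q.[s] ^+ k by rewrite exprn_ge0// ltW.
    have nz : q.[s] ^+ k != 0 by rewrite expf_neq0// gt_eqF.
    rewrite normrM normfV (ger0_norm qs0) -/C.
    have qn : `|q.[s]| = q.[s] by rewrite gtr0_norm.
    have qs' : q.[s] = `|r.[s]| * `|s - t|.
      by rewrite -[LHS]qn {1}qE hornerM hornerXsubC normrM.
    rewrite !hornerM !normrM qn !exprS.
    move: (q.[s] ^+ k) nz => K nz; rewrite {1}qs'.
    have -> // : `|p.[s]| / K * (C * (`|r.[s]| * `|s - t| * (q.[s] * K))) =
      `|s - t| * (C * (`|p.[s]| * `|r.[s]| * q.[s])) by field.
Qed.

Lemma smooth_bump p q k : smooth (bump p q k).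
Proof.
pose step (pk : {poly R} * nat) := (pk.1^`() * q ^+ 2 - pk.2%:R *: (pk.1 * q^`() * q) + pk.1 * q^`(), pk.2.+2).
exists (fun n => bump (iter n step (p, k)).1 q (iter n step (p, k)).2) => // n x.
exact: is_derive_bump.
Qed.

End smooth_functions.

Section ae.
Context {d} {T : measurableType d} {R : realType} (mu : {measure set T -> \bar R}).

Lemma ae_imp (P Q : T -> Prop) : (forall x, P x -> Q x) ->
  {ae mu, forall x, P x} -> {ae mu, forall x, Q x}.
Proof. by move=> PQ; apply: filterS => //; exact: (ae_filter_ringOfSetsType mu). Qed.

Lemma ae_imp2 (P Q S : T -> Prop) : (forall x, P x -> Q x -> S x) ->
  {ae mu, forall x, P x} -> {ae mu, forall x, Q x} -> {ae mu, forall x, S x}.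
Proof. by move=> PQ; apply: filterS2 => //; exact: (ae_filter_ringOfSetsType mu). Qed.

End ae.

(** * Primitives of integrable functions *)

Section primitives.
Context {R : realType}.
Local Notation leb := (@lebesgue_measure R).
Implicit Types (D : set R) (h : R -> R).

Lemma lebesgue_measure_ocitv (x y : R) : x <= y -> leb `]x, y]%classic = (y - x)%:E.
Proof.
rewrite le_eqVlt => /predU1P[->|xy]; rewrite lebesgue_measure_itv /= lte_fin ?ltxx ?subrr//.
by rewrite xy.
Qed.

Lemma integrable_cst_finite d (S : measurableType d) (mu : {measure set S -> \bar R})
    (D : set S) (c : R) : measurable D -> (mu D < +oo)%E -> mu.-integrable D (EFin \o cst c).
Proof.
move=> mD fD; apply/integrableP; split; first by apply/measurable_EFinP; exact: measurable_cst.
rewrite (_ : (fun x => _) = cst (`|c|%:E)%E)// integral_cst// lte_mul_pinfty//.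
Qed.

Lemma Rintegral_eq0 d (S : measurableType d) (mu : {measure set S -> \bar R})
    (D : set S) (f : S -> R) : (forall x, D x -> f x = 0) -> \int[mu]_(x in D) f x = 0.
Proof.
by move=> f0; rewrite /Rintegral integral0_eq// => x Dx; rewrite f0.
Qed.

Definition prim D h (x : R) : R := \int[leb]_(t in `]-oo, x]) (h \_ D) t.

Lemma integrable_patch D h : measurable D -> leb.-integrable D (EFin \o h) ->
  leb.-integrable [set: R] (EFin \o (h \_ D)).
Proof. by move=> mD ih; rewrite -restrict_EFin; apply/(integrable_mkcond _ _).1. Qed.

Lemma prim_sub D h x y : measurable D -> leb.-integrable D (EFin \o h) -> x <= y ->
  prim D h y - prim D h x = \int[leb]_(t in `]x, y]) (h \_ D) t.
Proof.
move=> mD ih xy; rewrite /prim Rintegral_itvB//.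
by apply: integrableS (integrable_patch mD ih).
Qed.

Lemma tail_prim D h x : measurable D -> leb.-integrable D (EFin \o h) ->
  tail D h x = \int[leb]_(t in D) h t - prim D h x.
Proof.
move=> mD ih; have ih' := integrable_patch mD ih.
rewrite [X in X - _]Rintegral_mkcond -set_itvNyy /prim Rintegral_itvB//; last by rewrite set_itvNyy.
rewrite Rintegral_itv_obnd_cbnd; last first.
  by apply: integrableS ih'.
rewrite /tail Rintegral_mkcond [RHS]Rintegral_mkcond; apply: eq_Rintegral => t _.
rewrite !patchE mem_setE in_itv /= andbT.
by case: (t \in D); case: (x <= t); rewrite ?mulr1 ?mulr0.
Qed.

Lemma primB D h g x : measurable D -> leb.-integrable D (EFin \o h) ->
  leb.-integrable D (EFin \o g) ->
  prim D (fun t => h t - g t) x = prim D h x - prim D g x.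
Proof.
move=> mD ih ig; rewrite /prim -RintegralB//.
- by apply: eq_Rintegral => t _; rewrite !patchE; case: (t \in D); rewrite ?subrr.
- exact: integrableS (integrable_patch mD ih).
- exact: integrableS (integrable_patch mD ig).
Qed.

Lemma prim_lipschitz D h M x y : measurable D -> leb.-integrable D (EFin \o h) ->
  (forall t, D t -> `|h t| <= M) -> x <= y ->
  `|prim D h y - prim D h x| <= `|M| * (y - x).
Proof.
move=> mD ih hM xy; rewrite prim_sub//.
have ih' : leb.-integrable `]x, y] (EFin \o (h \_ D)).
  by apply: integrableS (integrable_patch mD ih).
have vol := lebesgue_measure_ocitv xy.
apply: le_trans (le_normr_Rintegral _ ih') _ => //.
apply: (@le_trans _ _ (\int[leb]_(t in `]x, y]) (cst `|M| t))).
  apply: le_Rintegral => //.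
  - exact: integrable_norm.
  - by apply: integrable_cst_finite => //; rewrite [X in (X < _)%E]vol ltry.
  - move=> t _; rewrite patchE; case: ifPn => [/set_mem Dt|_]; last by rewrite normr0.
    exact: le_trans (hM t Dt) (ler_norm _).
rewrite Rintegral_cst//; change (`|M| * fine (leb `]x, y]%classic) <= `|M| * (y - x)).
by rewrite vol.
Qed.


Lemma prim_left (a b : R) h : prim `]a, b[%classic h a = 0.
Proof.
apply: Rintegral_eq0 => t /=; rewrite in_itv /= => ta.
by rewrite patchE mem_setE in_itv /= ltNge ta.
Qed.

End primitives.

(** * Smooth approximation of indicators of intervals *)

Section bumps.
Context {R : realType}.
Local Notation leb := (@lebesgue_measure R).
Implicit Types (x y t : R) (f : R -> R).

(** On ]x, y[ this is exp(-1 / ((n+1) (t-x) (y-t))), which tends to 1 as n grows. *)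
Definition bump_itv x y n : R -> R :=
  bump 1 (n.+1%:R *: (('X - x%:P) * (y%:P - 'X))) 0.

Lemma bump_itvE x y n t : bump_itv x y n t =
  if 0 < (t - x) * (y - t) then expR (- (n.+1%:R * ((t - x) * (y - t)))^-1) else 0.
Proof.
have qE : (n.+1%:R *: (('X - x%:P) * (y%:P - 'X))).[t] = n.+1%:R * ((t - x) * (y - t)).
  by rewrite hornerZ hornerM hornerXsubC hornerD hornerN hornerX hornerC.
by rewrite /bump_itv /bump qE pmulr_rgt0// -polyC1 hornerC expr0 divr1 mul1r.
Qed.

Lemma bump_itv_ge0 x y n t : 0 <= bump_itv x y n t.
Proof. by rewrite bump_itvE; case: ifP => // _; exact: expR_ge0. Qed.

Lemma bump_itv_le1 x y n t : bump_itv x y n t <= 1.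
Proof.
rewrite bump_itvE; case: ifP => // h; rewrite -[leRHS]expR0 ler_expR oppr_le0.
by rewrite invr_ge0 mulr_ge0// ltW.
Qed.

Lemma bump_itv_out x y n t : x < y -> ~ (x <= t <= y) -> bump_itv x y n t = 0.
Proof.
move=> xy h; rewrite bump_itvE; case: ifPn => // p; exfalso; apply: h.
have [tx|xt] := leP t x; have [yt|ty] := leP y t; rewrite ?(ltW xt) ?(ltW ty)//; exfalso.
- lra.
- by have := mulr_ge0 (_ : 0 <= x - t) (_ : 0 <= y - t); rewrite !subr_ge0 => /(_ tx (ltW ty)); lra.
- by have := mulr_ge0 (_ : 0 <= t - x) (_ : 0 <= t - y); rewrite !subr_ge0 => /(_ (ltW xt) yt); lra.
Qed.

Lemma bump_itv_cvg x y t : x < y -> bump_itv x y n t @[n --> \oo] --> (\1_(`]x, y[%classic) t : R).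
Proof.
move=> xy; rewrite indicE mem_setE in_itv /=.
have E : (0 < (t - x) * (y - t)) = (x < t < y).
  apply/idP/andP => [p|[p1 p2]]; last by rewrite mulr_gt0// subr_gt0.
  have [tx|xt] := leP t x; have [yt|ty] := leP y t => //; exfalso.
  - lra.
  - by have := mulr_ge0 (_ : 0 <= x - t) (_ : 0 <= y - t); rewrite !subr_ge0 => /(_ tx (ltW ty)); lra.
  - by have := mulr_ge0 (_ : 0 <= t - x) (_ : 0 <= t - y); rewrite !subr_ge0 => /(_ (ltW xt) yt); lra.
case: (boolP (x < t < y)) => h; last first.
  have -> : (fun n => bump_itv x y n t) = (fun=> 0).
    by apply/funext => n; rewrite bump_itvE E (negbTE h).
  exact: cvg_cst.
have -> : (fun n => bump_itv x y n t) =
    (fun n => expR (- (n.+1%:R^-1 * ((t - x) * (y - t))^-1))).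
  by apply/funext => n; rewrite bump_itvE E h invfM.
rewrite -[X in _ --> X]expR0.
apply: continuous_cvg; first exact: continuous_expR.
rewrite -[X in _ --> X](oppr0); apply: cvgN.
rewrite -[X in _ --> X](mul0r ((t - x) * (y - t))^-1); apply: cvgM; last exact: cvg_cst.
exact: cvg_harmonic.
Qed.

Lemma measurable_bump_itv x y n (D : set R) : measurable D -> measurable_fun D (bump_itv x y n).
Proof.
move=> mD; apply: (measurable_funS measurableT) => //; apply: continuous_measurable_fun => t.
apply/differentiable_continuous/derivable1_diffP.
by have [] := is_derive_bump 1 (n.+1%:R *: (('X - x%:P) * (y%:P - 'X))) 0 t.
Qed.

End bumps.

(** * The du Bois-Reymond lemma *)

Section du_bois_reymond.
Context {R : realType}.
Local Notation leb := (@lebesgue_measure R).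
Context (a b : R).
Local Notation Omega := (`]a, b[%classic : set R).
Implicit Types (x y t : R) (w f : R -> R).

Let mO : measurable (Omega : set (measurableTypeR R)). Proof. exact: measurable_itv. Qed.

Lemma integral_bump_itv_cvg w x y : leb.-integrable Omega (EFin \o w) -> x < y ->
  \int[leb]_(t in Omega) (w t * bump_itv x y n t) @[n --> \oo] -->
  \int[leb]_(t in Omega) (w t * \1_(`]x, y[%classic) t).
Proof.
move=> iw xy.
have mw : measurable_fun Omega w by apply/measurable_EFinP; exact: measurable_int iw.
have m1 : measurable_fun Omega (\1_(`]x, y[%classic) : R -> R).
  by apply: (measurable_funS measurableT) => //; apply: measurable_indic; exact: measurable_itv.
have cvF : forall t, (w t * bump_itv x y n t)%:E @[n --> \oo] --> (w t * \1_(`]x, y[%classic) t)%:E.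
  move=> t; apply: cvg_EFin; first exact: nearW.
  by apply: cvgM; [exact: cvg_cst|exact: bump_itv_cvg].
have [||||| iL _ h] := @dominated_convergence _ _ _ leb Omega mO
  (fun n t => (w t * bump_itv x y n t)%:E)
  (fun t => (w t * \1_(`]x, y[%classic) t)%:E) (fun t => `|w t|%:E).
- move=> n; apply/measurable_EFinP; apply: measurable_funM => //.
  exact: measurable_bump_itv.
- by apply/measurable_EFinP; exact: measurable_funM.
- by apply: aeW => t _; exact: cvF.
- exact: integrable_norm.
- apply: aeW => t n _ /=; rewrite lee_fin normrM ler_piMr// ger0_norm ?bump_itv_ge0//.
  exact: bump_itv_le1.
apply: fine_cvg; rewrite fineK//.
exact: integrable_fin_num.
Qed.

Definition test_domain f := exists2 mM : R * R, a < mM.1 /\ mM.2 < b &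
  forall x, ~ (mM.1 <= x <= mM.2) -> f x = 0.

(** Testing with combinations of two bumps and letting them tend to indicators shows that the
    integral of w over an interval is proportional to its length. With c the ratio, the primitive of
    w - c is constant on ]a, b[, and Lebesgue differentiation gives w = c almost everywhere. *)
Lemma du_bois_reymond w : a < b -> leb.-integrable Omega (EFin \o w) ->
  (forall psi, smooth psi -> test_domain psi -> \int[leb]_(t in Omega) psi t = 0 ->
    \int[leb]_(t in Omega) (w t * psi t) = 0) ->
  exists c, {ae leb, forall x, x \in Omega -> w x = c}.
Proof.
move=> ab iw hw.
have fO : (leb Omega < +oo)%E by rewrite lebesgue_measure_itv /= lte_fin ab ltry.
have i1 : leb.-integrable Omega (EFin \o cst 1) by exact: integrable_cst_finite.
have ibump v x y n : leb.-integrable Omega (EFin \o v) ->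
    leb.-integrable Omega (EFin \o (fun t => v t * bump_itv x y n t)).
  move=> iv; apply: (@integrable_mul_bounded _ _ _ _ _ _ _ 1) => //.
    exact: measurable_bump_itv.
  by move=> t _; rewrite ger0_norm ?bump_itv_ge0// bump_itv_le1.
have iind v x y : leb.-integrable Omega (EFin \o v) ->
    leb.-integrable Omega (EFin \o (fun t => v t * \1_(`]x, y[%classic) t)).
  move=> iv; apply: (@integrable_mul_bounded _ _ _ _ _ _ _ 1) => //.
  by move=> t _; rewrite indicE; case: (_ \in _); rewrite ?normr0 ?normr1.
pose I v x y := \int[leb]_(t in Omega) (v t * \1_(`]x, y[%classic) t).
pose J v x y n := \int[leb]_(t in Omega) (v t * bump_itv x y n t).
have I1 x y : a < x -> x < y -> y < b -> I (cst 1) x y = y - x.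
  move=> ax xy yb; rewrite /I /Rintegral.
  under eq_integral do rewrite /= mul1r.
  rewrite integral_indic//.
  rewrite setIidl; last by apply: subset_itvW; exact/ltW.
  have vol : leb `]x, y[%classic = (y - x)%:E by rewrite lebesgue_measure_itv /= lte_fin xy.
  by rewrite [X in fine X]vol.
have lincomb v x y x' y' n (p q : R) : leb.-integrable Omega (EFin \o v) ->
    \int[leb]_(t in Omega) (v t * (p * bump_itv x y n t - q * bump_itv x' y' n t)) =
    p * J v x y n - q * J v x' y' n.
  move=> iv; have j1 := ibump v x y n iv; have j2 := ibump v x' y' n iv.
  have e1 := RintegralZl p mO j1; have e2 := RintegralZl q mO j2.
  have e3 := RintegralB mO (integrableZl mO p j1) (integrableZl mO q j2).
  rewrite /= in e3; rewrite /J -e1 -e2 -e3.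
  apply: eq_Rintegral => t _; rewrite mulrBr; congr (_ - _); exact: mulrCA.
have cJ v x y : leb.-integrable Omega (EFin \o v) -> x < y -> J v x y @ \oo --> I v x y.
  exact: integral_bump_itv_cvg.
have primI c x y : a < x -> x < y -> y < b ->
    prim Omega (fun t => w t - c) y - prim Omega (fun t => w t - c) x =
    I w x y - c * I (cst 1) x y.
  move=> ax xy yb.
  have iv : leb.-integrable Omega (EFin \o (fun t => w t - c)).
    by exact: (integrableB mO iw (integrable_cst_finite c mO fO)).
  rewrite prim_sub//; last exact: ltW.
  rewrite -Rintegral_itv_bndo_bndc; last first.
    by apply: integrableS (integrable_patch mO iv).
  have e1 := RintegralZl c mO (iind _ x y i1).
  have e2 := RintegralB mO (iind _ x y iw) (integrableZl mO c (iind _ x y i1)).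
  rewrite /= in e2; rewrite /I -e1 -e2.
  rewrite [LHS]Rintegral_mkcond [RHS]Rintegral_mkcond.
  apply: eq_Rintegral => t _; rewrite !patchE indicE !mem_setE.
  by case: (t \in `]a, b[); case: (t \in `]x, y[); rewrite /= ?mulr0 ?mulr1 ?subr0.
clearbody I J.
have prop x y x' y' : a < x -> x < y -> y < b -> a < x' -> x' < y' -> y' < b ->
    I (cst 1) x' y' * I w x y = I (cst 1) x y * I w x' y'.
  move=> ax xy yb ax' xy' yb'.
  have key n (p q : R) : p * J (cst 1) x y n - q * J (cst 1) x' y' n = 0 ->
      p * J w x y n - q * J w x' y' n = 0.
    rewrite -!lincomb// => h; apply: hw; last first.
    - by rewrite -[RHS]h; apply: eq_Rintegral => t _; rewrite mul1r.
    - exists (Num.min x x', Num.max y y').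
        by rewrite /= lt_min gt_max ax ax' yb yb'.
      move=> t /= ht; have h1 : bump_itv x y n t = 0.
        by apply: bump_itv_out => // /andP[h1 h2]; apply: ht; rewrite ge_min le_max h1 h2.
      have h2 : bump_itv x' y' n t = 0.
        by apply: bump_itv_out => // /andP[h2 h3]; apply: ht; rewrite ge_min le_max h2 h3 !orbT.
      by rewrite h1 h2 !mulr0 subr0.
    - by apply: smooth_lincomb; exact: smooth_bump.
  (* Each bump is weighted by the integral of the other, so that the combination has mean zero. *)
  have E n : J (cst 1) x' y' n * J w x y n = J (cst 1) x y n * J w x' y' n.
    by apply/eqP; rewrite -subr_eq0 key// mulrC subrr.
  have c1 := cvgM (cJ _ _ _ i1 xy') (cJ _ _ _ iw xy).
  have c2 := cvgM (cJ _ _ _ i1 xy) (cJ _ _ _ iw xy').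
  rewrite -(cvg_lim _ (c1 _))// -(cvg_lim _ (c2 _))//; congr (lim (_ @ \oo)).
  exact/funext.
(* The reference interval is the middle third of ]a, b[; c is the mean of w over it. *)
pose x0 := a + (b - a) / 3; pose y0 := a + (b - a) / 3 * 2.
have [ax0 xy0 yb0] : [/\ a < x0, x0 < y0 & y0 < b] by rewrite /x0 /y0; split; lra.
pose c := I w x0 y0 / (y0 - x0).
have Iw x y : a < x -> x < y -> y < b -> I w x y = c * (y - x).
  move=> ax xy yb; have := prop x y x0 y0 ax xy yb ax0 xy0 yb0.
  rewrite !I1// => h; rewrite /c mulrAC [X in X / _]mulrC -h mulrC mulKf//.
  by rewrite gt_eqF// subr_gt0.
exists c.
pose v t := w t - c.
have iv : leb.-integrable Omega (EFin \o v).
  by exact: (integrableB mO iw (integrable_cst_finite c mO fO)).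
have P x y : a < x -> x < y -> y < b -> prim Omega v x = prim Omega v y.
  move=> ax xy yb; apply/eqP; rewrite eq_sym -subr_eq0 primI//.
  by rewrite I1// Iw// subrr.
have iv' := integrable_patch mO iv.
have locv : locally_integrable [set: R] (v \_ Omega).
  by apply: open_integrable_locally => //; exact: openT.
have ftc : {ae leb, forall x : R, derivable (prim Omega v) x 1 /\
    (prim Omega v)^`()%classic x = (v \_ Omega) x}.
  by apply: FTC1Ny => // y; exact: integrableS iv'.
apply: ae_imp ftc => x [_ dx] xO.
have : (prim Omega v)^`()%classic x = 0.
  rewrite derive1E (near_eq_derive (g := cst (prim Omega v x)))// ?derive_cst//.
  have xO' : x \in `]a, b[ by move: xO; rewrite mem_setE.
  have : \forall y \near x, y \in `]a, b[ by exact: near_in_itvoo xO'.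
  apply: filterS => y; rewrite in_itv /= => /andP[ay yb].
  have /andP[ax xb] : a < x < b by move: xO; rewrite mem_setE in_itv.
  have [xy|yx|->//] := ltgtP x y; first by rewrite -(P x y).
  exact: P.
rewrite dx => v0; apply/eqP; rewrite -subr_eq0 -/(v x).
by move: v0; rewrite patchE xO => ->.
Qed.

End du_bois_reymond.

(** * Functions of bounded variation and distribution functions *)

Section jordan_parts.
Context {R : realType}.
Local Notation T := (measurableTypeR R).
Local Notation leb := (@lebesgue_measure R).
Implicit Types (nu : {charge set T -> \bar R}) (D : set R) (h : R -> R).

(* The Hahn decomposition chosen in the definitions of [variation] and [charge_integral]. *)
Definition chosen_hahn nu := projT2 (cid (projT2 (cid (Hahn_decomposition nu)))).

Definition posv nu : {finite_measure set T -> \bar R} := jordan_pos (chosen_hahn nu).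

Definition negv nu : {finite_measure set T -> \bar R} := jordan_neg (chosen_hahn nu).

Lemma posv_negv nu (A : set T) : measurable A -> nu A = (posv nu A - negv nu A)%E.
Proof. by move=> mA; rewrite (jordan_decomp (chosen_hahn nu) mA) /cadd /= /cscale EFinN mulN1e. Qed.

Definition cdfc nu (t : R) : R := cdf (posv nu) t - cdf (negv nu) t.

Lemma measurable_cdfc nu D : measurable D -> measurable_fun D (cdfc nu).
Proof.
move=> mD; apply: measurable_funTS; apply: measurable_funB; exact: measurable_cdf.
Qed.

Lemma cdf_ge0 (mu : {finite_measure set T -> \bar R}) t : 0 <= cdf mu t.
Proof. exact: fine_ge0. Qed.

Lemma cdf_le (mu : {finite_measure set T -> \bar R}) t : cdf mu t <= fine (mu setT).
Proof.
apply: fine_le; rewrite ?fin_num_measure//.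
by apply: le_measure; rewrite ?inE.
Qed.

Lemma cdfc_bounded nu : exists M, forall t, `|cdfc nu t| <= M.
Proof.
exists (fine (posv nu setT) + fine (negv nu setT)) => t.
apply: le_trans (ler_normB _ _) _.
by rewrite !ger0_norm ?cdf_ge0// lerD ?cdf_le.
Qed.

Lemma integrable_mul_cdfc nu D h : measurable D -> leb.-integrable D (EFin \o h) ->
  leb.-integrable D (EFin \o (fun t => h t * cdfc nu t)).
Proof.
move=> mD ih; have [M hM] := cdfc_bounded nu.
apply: (@integrable_mul_bounded _ _ _ _ _ _ _ M) => //.
by apply: measurable_cdfc.
Qed.

Lemma charge_integral_tail nu D h : measurable D -> leb.-integrable D (EFin \o h) ->
  charge_integral nu (tail D h) = \int[leb]_(t in D) (h t * cdfc nu t).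
Proof.
move=> mD ih.
have [_ i1 e1] := fubini_tail (posv nu) mD ih.
have [_ i2 e2] := fubini_tail (negv nu) mD ih.
transitivity (\int[posv nu]_x tail D h x - \int[negv nu]_x tail D h x) => //.
rewrite e1 e2 -RintegralB//.
by apply: eq_Rintegral => t _; rewrite /cdfc mulrBr.
Qed.

Lemma charge_integral_tailN nu D h : measurable D -> leb.-integrable D (EFin \o h) ->
  charge_integral nu (fun x => - tail D h x) = - charge_integral nu (tail D h).
Proof.
move=> mD ih.
have [i1 _ _] := fubini_tail (posv nu) mD ih.
have [i2 _ _] := fubini_tail (negv nu) mD ih.
have N (mu : {finite_measure set T -> \bar R}) : mu.-integrable setT (EFin \o tail D h) ->
    \int[mu]_x - tail D h x = - \int[mu]_x tail D h x.
  move=> i; rewrite -[RHS]mulN1r -RintegralZl//.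
  by apply: eq_Rintegral => x _; rewrite mulN1r.
transitivity (\int[posv nu]_x - tail D h x - \int[negv nu]_x - tail D h x) => //.
by rewrite !N// -opprD.
Qed.

End jordan_parts.

(** * BV functions as distribution functions *)

Section distributional_derivative.
Context {R : realType} (a b : R).
Local Notation T := (measurableTypeR R).
Local Notation leb := (@lebesgue_measure R).
Local Notation Omega := (`]a, b[%classic : set R).
Implicit Types (nu : {charge set T -> \bar R}) (f phi psi u : R -> R).

Let mO : measurable (Omega : set T). Proof. exact: measurable_itv. Qed.

Lemma continuous_integrable_itv f : continuous f -> leb.-integrable Omega (EFin \o f).
Proof.
move=> cf; have i : leb.-integrable `[a, b] (EFin \o f).
  apply: continuous_compact_integrable; first exact: segment_compact.
  exact: continuous_subspaceT.
by apply: integrableS i => //; exact: subset_itvW.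
Qed.

Lemma is_derive_prim f : continuous f -> (forall x, ~ (a < x < b) -> f x = 0) ->
  forall x : R, is_derive x 1 (prim Omega f) (f x).
Proof.
move=> cf f0 x.
have fE : f \_ Omega = f.
  apply/funext => t; rewrite patchE mem_setE in_itv /=.
  by case: ifPn => // /negP h; rewrite f0.
have i := integrable_patch mO (continuous_integrable_itv cf).
have [d1 d2] : derivable (prim Omega f) x 1 /\ (prim Omega f)^`()%classic x = (f \_ Omega) x.
  apply: (@continuous_FTC1 R _ -oo%O x (x + 1)) => //.
  - by rewrite ltrDl.
  - exact: integrableS i.
  - by rewrite ltNyr.
  - by rewrite fE; exact: cf.
apply: DeriveDef; first exact: d1.
by rewrite -derive1E -[RHS]/(f x) -[in RHS]fE -d2.
Qed.

(** Rewriting phi as a tail of its derivative brings the pairing with a charge into the form to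
    which Fubini applies. *)
Lemma test_function_tail phi : test_function a b phi ->
  [/\ continuous phi^`()%classic, leb.-integrable Omega (EFin \o phi^`()%classic),
    \int[leb]_(t in Omega) phi^`()%classic t = 0 &
    phi = fun x => - tail Omega (phi^`()%classic) x].
Proof.
move=> [sm _ supp].
have dphi x : derivable phi x 1 by exact: sm 0%N x.
have cphi : continuous phi^`()%classic.
  by move=> x; apply/differentiable_continuous/derivable1_diffP; exact: (sm 1%N x).
have out x : ~ (a < x < b) -> \forall y \near x, phi y = 0.
  move=> xO; have : nbhs x (~` closure [set x | phi x != 0]).
    apply: open_nbhs_nbhs; split; first by rewrite openC; exact: closed_closure.
    by move=> /supp /=; rewrite in_itv.
  by apply: filterS => y; apply: contra_notP => h; apply: subset_closure; exact/eqP.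
have phi0 x : ~ (a < x < b) -> phi x = 0.
  by move=> /out h; exact: nbhs_singleton h.
have dphi0 x : ~ (a < x < b) -> phi^`()%classic x = 0.
  by move=> /out h; rewrite derive1E (near_eq_derive (g := cst 0))// derive_cst.
have ip := continuous_integrable_itv cphi.
have pE : prim Omega phi^`()%classic = phi.
  have dp := is_derive_prim cphi dphi0.
  apply/funext => x; apply/eqP; rewrite -subr_eq0; apply/eqP.
  have -> : prim Omega phi^`()%classic x - phi x = prim Omega phi^`()%classic a - phi a.
    apply: (@is_derive_0_is_cst R (fun x => prim Omega phi^`()%classic x - phi x)) => y.
    have dphi' : is_derive y 1 phi (phi^`()%classic y).
      by apply: DeriveDef; [exact: dphi|rewrite derive1E].
    by have dpy := dp y; apply: is_derive_eq; rewrite subrr.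
  rewrite phi0 ?ltxx// subr0 /prim Rintegral_mkcond (_ : _ \_ _ = cst 0) ?Rintegral_cst ?mul0r//.
  apply/funext => t; rewrite !patchE !mem_setE !in_itv /=.
  by case: ltP; case: leP => //; lra.
have i0 : \int[leb]_(t in Omega) phi^`()%classic t = 0.
  have := tail_prim b mO ip; rewrite pE phi0 ?ltxx ?andbF// subr0 => <-.
  by apply: Rintegral_eq0 => t /=; rewrite in_itv /= => /andP[_ tb]; rewrite leNgt tb mulr0.
split => //; rewrite -[LHS]pE; apply/funext => x.
by rewrite tail_prim// i0 sub0r opprK.
Qed.

(** The converse construction: psi has mean zero, so its primitive vanishes to the right of its
    support as well as to the left. *)
Lemma test_function_prim psi : smooth psi -> test_domain a b psi ->
  \int[leb]_(t in Omega) psi t = 0 ->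
  [/\ test_function a b (prim Omega psi), (prim Omega psi)^`()%classic = psi,
    leb.-integrable Omega (EFin \o psi) & prim Omega psi = fun x => - tail Omega psi x].
Proof.
move=> sm [[m M] /= [am Mb] out] i0.
have cpsi := smooth_continuous sm.
have out' x : ~ (a < x < b) -> psi x = 0.
  by move=> h; apply: out => /andP[h1 h2]; apply: h; lra.
have dp := is_derive_prim cpsi out'.
have ip := continuous_integrable_itv cpsi.
have pE : prim Omega psi = fun x => - tail Omega psi x.
  by apply/funext => x; rewrite tail_prim// i0 sub0r opprK.
have dE : (prim Omega psi)^`()%classic = psi.
  by apply/funext => x; rewrite derive1E; have [_ ->] := dp x.
split => //.
have supp : closure [set x | prim Omega psi x != 0] `<=` `[m, M].
  rewrite [X in _ `<=` X](closure_id _).1; last exact: itv_closed.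
  apply: closure_subset => x /=; apply: contra_neqT; rewrite in_itv /= => h.
  have [xm|mx] := ltP x m.
    apply: Rintegral_eq0 => t /=; rewrite in_itv /= patchE => tx.
    by case: ifP => // _; apply: out => /andP[mt _]; lra.
  have Mx : M < x by rewrite ltNge; apply/negP => xM; move: h; rewrite mx xM.
  rewrite pE; apply/eqP; rewrite oppr_eq0; apply/eqP.
  apply: Rintegral_eq0 => t _; case: leP => [xt|]; last by rewrite mulr0.
  by rewrite out ?mul0r// => /andP[_ tM]; lra.
split.
- by move=> n x; apply: smooth_derive1n; exact: smooth_antiderivative dp.
- by apply: subclosed_compact supp; [exact: closed_closure|exact: segment_compact].
- by apply: subset_trans supp _ => x /=; rewrite !in_itv /= => /andP[? ?]; apply/andP; lra.
Qed.

(** For phi the primitive of psi, the defining identity of nu reads, after integration by parts, as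
    the equality of the integrals of u psi and of [cdfc nu] psi. The du Bois-Reymond lemma applies
    to the difference u - [cdfc nu]. *)
Theorem BV_representation u nu : a < b -> leb.-integrable Omega (EFin \o u) ->
  is_distributional_derivative a b u nu ->
  exists c, {ae leb, forall x, x \in Omega -> u x = c + cdfc nu x}.
Proof.
move=> ab iu [_ der].
have fO : (leb Omega < +oo)%E by rewrite lebesgue_measure_itv /= lte_fin ab ltry.
have i1 : leb.-integrable Omega (EFin \o cst 1) by exact: integrable_cst_finite.
have ic : leb.-integrable Omega (EFin \o cdfc nu).
  have := integrable_mul_cdfc nu mO i1; congr (_.-integrable _ _).
  by apply/funext => t /=; rewrite mul1r.
have [|psi sm dom i0|c hc] := @du_bois_reymond R a b (fun x => u x - cdfc nu x) ab.
- exact: (integrableB mO iu ic).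
- have [tf dE ipsi pE] := test_function_prim sm dom i0.
  have := der _ tf; rewrite dE pE charge_integral_tailN// charge_integral_tail// opprK => e.
  have ipc := integrable_mul_cdfc nu mO ipsi.
  have cpsi := smooth_continuous sm.
  have [|x _ hM] := @EVT_max R (fun t => `|psi t|) a b (ltW ab).
    by apply: continuous_subspaceT => x; apply: cvg_norm; exact: cpsi.
  have ipu : leb.-integrable Omega (EFin \o (fun t => u t * psi t)).
    apply: (@integrable_mul_bounded _ _ _ _ _ _ _ `|psi x|) => //.
      by apply/measurable_EFinP; exact: measurable_int ipsi.
    by move=> t; rewrite /= in_itv => /andP[at_ tb]; apply: hM; rewrite in_itv /= !ltW.
  transitivity (\int[leb]_(t in Omega) (u t * psi t - psi t * cdfc nu t)).
    by apply: eq_Rintegral => t _; rewrite mulrBl [X in _ - X]mulrC.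
  by rewrite (RintegralB mO ipu ipc) e subrr.
exists c; apply: ae_imp hc => x h /h <-; rewrite subrK//.
Qed.

Lemma ae_eq_Rintegral_itv f g : measurable_fun Omega f -> measurable_fun Omega g ->
  {ae leb, forall x, x \in Omega -> f x = g x} ->
  \int[leb]_(t in Omega) f t = \int[leb]_(t in Omega) g t.
Proof.
move=> mf mg fg; rewrite /Rintegral; congr fine; apply: ae_eq_integral => //.
- exact/measurable_EFinP.
- exact/measurable_EFinP.
- by apply: ae_imp fg => x h /mem_set /h ->.
Qed.

Lemma is_distributional_derivative_cdfc u nu c : a < b ->
  leb.-integrable Omega (EFin \o u) ->
  (forall A : set T, measurable A -> nu A = nu (A `&` Omega)) ->
  {ae leb, forall x, x \in Omega -> u x = c + cdfc nu x} ->
  is_distributional_derivative a b u nu.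
Proof.
move=> ab iu res hu; split => // phi tf.
have [cphi ip i0 phiE] := test_function_tail tf.
rewrite [in RHS]phiE charge_integral_tailN// charge_integral_tail// opprK.
have ic := integrable_mul_cdfc nu mO ip.
have ik := integrableZl mO c ip.
have mu_ : measurable_fun Omega u by apply/measurable_EFinP; exact: measurable_int iu.
have mp : measurable_fun Omega phi^`()%classic.
  by apply/measurable_EFinP; exact: measurable_int ip.
transitivity (\int[leb]_(t in Omega) (c * phi^`()%classic t + phi^`()%classic t * cdfc nu t)).
  apply: ae_eq_Rintegral_itv.
  - exact: measurable_funM.
  - apply: measurable_funD; apply: measurable_funM => //.
    exact: measurable_cdfc.
  - by apply: ae_imp hu => x h /h ->; rewrite mulrDl [X in _ + X]mulrC.
by rewrite (RintegralD mO ik ic) (RintegralZl c mO ip) i0 mulr0 add0r.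
Qed.

End distributional_derivative.

(** * Stieltjes measures and comparison of measures *)

Section stieltjes.
Context {R : realType}.
Local Notation T := (measurableTypeR R).
Implicit Types (A : R -> R) (m : {finite_measure set T -> \bar R}) (p q x y t : R).

Lemma stieltjes_ocitv (F : cumulative R R) x y : x <= y ->
  lebesgue_stieltjes_measure F `]x, y]%classic = (F y - F x)%:E.
Proof.
move=> xy; rewrite /lebesgue_stieltjes_measure /measure_extension.
by rewrite measurable_mu_extE /=; [rewrite wlength_itv_bnd|exact: is_ocitv].
Qed.

Lemma stieltjes_measure A : rc_nondecreasing A -> exists mu : {measure set T -> \bar R},
  forall x y, x <= y -> mu `]x, y]%classic = (A y - A x)%:E.
Proof.
move=> [nd rc].
have rcA : right_continuous A.
  move=> t; apply/cvgrPdist_lt => e e0; have [d d0 hd] := rc t e e0.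
  near=> x; have tx : t <= x by apply/ltW; near: x; exact: nbhs_right_gt.
  rewrite distrC ger0_norm ?subr_ge0 ?nd// ltrBlDl hd//.
  by near: x; apply: nbhs_right_lt; rewrite ltrDl.
pose F : cumulative R R := HB.pack A (isCumulative.Build R _ R A nd rcA).
exists (lebesgue_stieltjes_measure F) => x y xy.
exact: (stieltjes_ocitv F xy).
Unshelve. all: by end_near. Qed.

Lemma measure_unique_ocitv (m1 m2 : {measure set T -> \bar R}) :
  (forall x y, x <= y -> m1 `]x, y]%classic = m2 `]x, y]%classic) ->
  (forall x y, (m1 `]x, y]%classic < +oo)%E) ->
  forall B, measurable B -> m1 B = m2 B.
Proof.
move=> eq12 fin; apply: (@measure_unique _ R T (R.-ocitv.-measurable : set (set R))
  (fun k => `](- k%:R), k%:R]%classic)) => //.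
- by move=> X Y mX mY; exact: measurableI.
- by move=> k; exact: is_ocitv.
- by rewrite (bigcup_itvT false false).
- move=> X [[x y] _ <-] /=; have [xy|yx] := leP x y; first exact: eq12.
  by rewrite set_itv_ge ?measure0// bnd_simp -leNgt ltW.
Qed.

Lemma cdf_ocitv m x y : x <= y -> m `]x, y]%classic = (cdf m y - cdf m x)%:E.
Proof.
move=> xy; rewrite EFinB !fineK ?fin_num_measure//.
have -> : `]x, y]%classic = `]-oo, y]%classic `\` `]-oo, x]%classic.
  apply/seteqP; split=> t /=; rewrite !in_itv /=.
    by move=> /andP[xt ty]; split => //; apply/negP; rewrite -ltNge.
  by move=> [ty /negP]; rewrite -ltNge => ->.
rewrite measureD//; last by rewrite ltey_eq fin_num_measure.
by rewrite setIidr//; apply: subset_itvl; rewrite bnd_simp.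
Qed.

Lemma cdf_right_continuous m t e : 0 < e ->
  exists2 d : R, 0 < d & forall x, t <= x -> x < t + d -> cdf m x < cdf m t + e.
Proof.
move=> e0.
have c : m (`]-oo, t + n.+1%:R^-1]%classic) @[n --> \oo] --> m `]-oo, t]%classic.
  rewrite [in X in _ --> X](itvNycEbigcap false t).
  apply: (@nonincreasing_cvg_mu _ _ _ m (fun n => `]-oo, t + n.+1%:R^-1]%classic)) => //.
  - by rewrite ltey_eq fin_num_measure.
  - by apply: bigcap_measurable.
  - move=> k n kn; apply/subsetPset; apply: subset_itvl; rewrite bnd_simp lerD2l.
    by rewrite lef_pV2 ?posrE// ler_nat.
have : cdf m (t + n.+1%:R^-1) @[n --> \oo] --> cdf m t.
  by apply: fine_cvg; rewrite fineK ?fin_num_measure//; exact: c.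
move=> /cvgr_lt /(_ (cdf m t + e)); rewrite ltrDl => /(_ e0) [n _ hn].
exists n.+1%:R^-1; first by rewrite invr_gt0.
move=> x tx xn; apply: le_lt_trans (hn n (leqnn n)); apply: cdf_nd; exact: ltW.
Qed.

(** The difference of the distribution functions, clamped to [p, q], is nondecreasing and right
    continuous. Its Stieltjes measure mu satisfies m = m' + mu on ]p, q]. *)
Lemma le_measure_cdf m m' p q : p <= q ->
  (forall s t, p <= s -> s <= t -> t <= q -> cdf m s - cdf m' s <= cdf m t - cdf m' t) ->
  forall B, measurable B -> B `<=` `]p, q] -> (m' B <= m B)%E.
Proof.
move=> pq mono.
pose cl t := Num.max p (Num.min q t).
have clp t : p <= cl t by rewrite le_max lexx.
have clq t : cl t <= q by rewrite ge_max pq ge_min lexx.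
have cl_nd : {homo cl : x y / x <= y}.
  move=> x y xy; rewrite ge_max clp /= le_max; apply/orP; right.
  by rewrite le_min !ge_min lexx xy orbT.
pose A t := cdf m (cl t) - cdf m' (cl t).
have rcA : rc_nondecreasing A.
  split; first by move=> x y xy; apply: mono => //; exact: cl_nd.
  move=> t e e0.
  have [d d0 hd] := cdf_right_continuous m (cl t) e0; exists d => // x tx xd.
  have lip : cl x <= cl t + (x - t).
    rewrite {1}/cl ge_max; apply/andP; split; first by have := clp t; lra.
    have [qt|tq] := leP q t.
      have : q <= cl t by rewrite /cl (min_idPl qt) le_max lexx orbT.
      have : Num.min q x <= q by rewrite ge_min lexx.
      lra.
    have : t <= cl t by rewrite /cl (min_idPr (ltW tq)) le_max lexx orbT.
    have : Num.min q x <= x by rewrite ge_min lexx orbT.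
    lra.
  have := hd (cl x) (cl_nd _ _ tx) ltac:(lra); have := cdf_nd m' (cl_nd _ _ tx).
  by rewrite /A; lra.
have [mu hmu] := stieltjes_measure rcA.
have mpq : measurable (`]p, q]%classic : set T) by exact: measurable_itv.
have itvI x y : `]x, y]%classic `&` `]p, q]%classic = `]cl x, cl y]%classic.
  apply/seteqP; split=> t /=; rewrite !in_itv /= gt_max gt_min le_max le_min;
    rewrite (ltNge q t) (leNgt t p) (ltNge x t);
    by case: (t <= q); case: (t <= y); case: (t <= x); case: (p < t) => //= -[].
have E : forall B, measurable B -> mrestr m mpq B = mrestr (measure_add m' mu) mpq B.
  apply: measure_unique_ocitv => x y; last first.
    by rewrite /mrestr (le_lt_trans (measureIl _ _ _))// ltey_eq fin_num_measure.
  move=> xy; rewrite /= /mrestr itvI cdf_ocitv ?cl_nd//.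
  apply/esym; apply: (eq_trans (measure_addE m' mu _)).
  apply: (eq_trans (congr2 adde (cdf_ocitv m' (cl_nd _ _ xy)) (hmu _ _ (cl_nd _ _ xy)))).
  change ((cdf m' (cl y) - cdf m' (cl x) + (A (cl y) - A (cl x)))%:E =
    (cdf m (cl y) - cdf m (cl x))%:E).
  congr EFin; rewrite /A.
  have clK t : cl (cl t) = cl t by rewrite {1}/cl (min_idPr (clq t)) (max_idPr (clp t)).
  by rewrite !clK; lra.
move=> B mB /setIidl BE; rewrite -BE; have := E B mB; rewrite /mrestr => ->.
by rewrite measure_addE leeDl.
Qed.

End stieltjes.

(** * The derivative of a taut string *)

Section saturation.
Context {R : realType}.
Local Notation T := (measurableTypeR R).
Local Notation leb := (@lebesgue_measure R).
Implicit Types (nu : {charge set T -> \bar R}) (m : {finite_measure set T -> \bar R}).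
Implicit Types (U k : R -> R) (s t x p q e : R).

Lemma posv_negv_singular nu :
  exists2 N : set T, measurable N & posv nu N = 0%E /\ negv nu (~` N) = 0%E.
Proof.
have [[mP _] [mN _] PN PN0] := chosen_hahn nu.
exists (projT1 (cid (projT2 (cid (Hahn_decomposition nu))))) => //; split.
  by rewrite /posv /= jordan_posE cjordan_posE /crestr0 mem_set// /crestr setIC PN0 charge0.
rewrite /negv /= jordan_negE cjordan_negE /crestr0 mem_set; last exact: measurableC.
by rewrite /crestr setIC setICr charge0 oppe0.
Qed.

(** The part of J in N is null for m, hence for m'; the part outside N is null for m' by
    singularity. *)
Lemma le_singular_null m m' (N J : set T) : measurable N -> measurable J ->
  m N = 0%E -> m' (~` N) = 0%E ->
  (forall B, measurable B -> B `<=` J -> (m' B <= m B)%E) -> m' J = 0%E.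
Proof.
move=> mN mJ mN0 mN'0 le; apply/eqP; rewrite eq_le measure_ge0 andbT.
have -> : J = (J `&` N) `|` (J `&` ~` N) by rewrite -setIUr setUv setIT.
have m1 : measurable (J `&` N) by exact: measurableI.
have m2 : measurable (J `&` ~` N) by apply: measurableI => //; exact: measurableC.
apply: le_trans (measureU2 _ m1 m2) _.
have z : (m' (J `&` ~` N) <= 0)%E.
  by rewrite -mN'0; apply: measureIr => //; exact: measurableC.
apply: le_trans (leeD (le _ m1 (@subIsetl _ _ _)) z) _.
by rewrite adde0 -mN0; apply: measureIr.
Qed.

(** The two bounds on increments say that k is the density of U without an integral, which lets the
    lemma serve - U and - k too. If k t < k s, right continuity makes the slope of U over a short
    step after s exceed the one over an equal step after t, against convexity. *)
Lemma cvx_slope_mono U k p q s t : cvx_on p q U ->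
  (forall s t M, p <= s -> s <= t -> t < q -> (forall x, s <= x -> x <= t -> k x <= M) ->
    U t - U s <= M * (t - s)) ->
  (forall s t M, p <= s -> s <= t -> t < q -> (forall x, s <= x -> x <= t -> M <= k x) ->
    M * (t - s) <= U t - U s) ->
  (forall t e, 0 < e -> exists2 d : R, 0 < d & forall x, t <= x -> x < t + d -> `|k x - k t| < e) ->
  p <= s -> s <= t -> t < q -> k s <= k t.
Proof.
move=> cv up lo rc ps; rewrite le_eqVlt => /predU1P[->//|st] tq.
rewrite leNgt; apply/negP => kts.
pose e := (k s - k t) / 3; have e0 : 0 < e by rewrite /e; lra.
have [d1 d10 h1] := rc s e e0; have [d2 d20 h2] := rc t e e0.
pose h := Num.min (Num.min d1 d2) (Num.min (t - s) (q - t)) / 2.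
have hh : 0 < 2 * h by rewrite mulrC divfK// !lt_min d10 d20 !subr_gt0 st.
have [l1 l2 l3 l4] : [/\ 2 * h <= d1, 2 * h <= d2, 2 * h <= t - s & 2 * h <= q - t].
  by rewrite mulrC divfK//; split; rewrite !ge_min lexx ?orbT.
clearbody h.
have x1 : (k s - e) * h <= U (s + h) - U s.
  have -> : h = s + h - s by lra.
  rewrite [X in U X](_ : _ = s + h); last by lra.
  apply: lo => //; try lra.
  move=> x sx xh; have := h1 x sx ltac:(lra); rewrite ltr_norml => /andP[? _]; lra.
have x2 : U (t + h) - U t <= (k t + e) * h.
  have -> : h = t + h - t by lra.
  rewrite [X in U X](_ : _ = t + h); last by lra.
  apply: up => //; try lra.
  move=> x tx xh; have := h2 x tx ltac:(lra); rewrite ltr_norml => /andP[_ ?]; lra.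
have c1 := cv s (s + h) t ps ltac:(lra) ltac:(lra) ltac:(lra).
have c2 := cv (s + h) t (t + h) ltac:(lra) ltac:(lra) ltac:(lra) ltac:(lra).
have e1 : s + h - s = h by lra.
have e2 : t + h - t = h by lra.
have e3 : t - (s + h) = t - s - h by lra.
rewrite e1 e3 in c1; rewrite e2 e3 in c2.
have c3 := le_trans c1 c2.
have w0 : 0 < t - s - h by lra.
rewrite ler_pM2r// in c3.
have : (k s - e) * h <= (k t + e) * h by lra.
have h0 : 0 < h by lra.
by rewrite ler_pM2r// /e; lra.
Qed.

Lemma cdfc_right_continuous nu t e : 0 < e ->
  exists2 d : R, 0 < d & forall x, t <= x -> x < t + d -> `|cdfc nu x - cdfc nu t| < e.
Proof.
move=> e0.
have [d1 d10 h1] := cdf_right_continuous (posv nu) t e0.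
have [d2 d20 h2] := cdf_right_continuous (negv nu) t e0.
exists (Num.min d1 d2); first by rewrite lt_min d10.
move=> x tx; rewrite -ltrBlDl lt_min => /andP[xd1 xd2].
have := h1 x tx ltac:(lra); have := h2 x tx ltac:(lra).
have := cdf_nd (posv nu) tx; have := cdf_nd (negv nu) tx.
by rewrite /cdfc ltr_norml => *; apply/andP; lra.
Qed.

(** Lindelöf: every point of S lies in a null interval with rational ends, and these are countably
    many. In the enumeration [F], codes of other pairs contribute the empty set. *)
Lemma negligible_cover m (a b : R) (S : set T) : S `<=` `]a, b[ ->
  (forall x, S x -> exists2 e : R, 0 < e & forall p q, a < p -> x - e < p -> p <= q -> q < b ->
    q < x + e -> m `]p, q]%classic = 0%E) ->
  m.-negligible S.
Proof.
move=> SO loc.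
pose good (z : rat * rat) := m `]ratr z.1, ratr z.2]%classic = 0%E.
pose F (n : nat) : set T := if unpickle n is Some z then
  (if `[< good z >] then `]ratr z.1, ratr z.2]%classic else set0) else set0.
apply: (@negligibleS _ _ _ m (\bigcup_n F n)); last first.
  apply: negligible_bigcup => n; rewrite /F.
  case: (unpickle n : option (rat * rat)) => [z|]; last exact: negligible_set0.
  case: asboolP => [gz|_]; last exact: negligible_set0.
  by apply/negligibleP => //; exact: measurable_itv.
move=> x Sx; have := SO x Sx; rewrite /= in_itv /= => /andP[ax xb].
have [e e0 he] := loc x Sx.
have xp : Num.max a (x - e) < x by rewrite gt_max ax; lra.
have xq' : x < Num.min b (x + e) by rewrite lt_min xb; lra.
have [p] := rat_in_itvoo xp; have [q] := rat_in_itvoo xq'.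
rewrite !in_itv /= lt_min gt_max => /andP[xq /andP[qb qe]] /andP[/andP[ap pe] px].
have gpq : good (p, q) by apply: he => //=; exact/ltW/(lt_trans px).
exists (pickle (p, q)); first exact: Logic.I.
by rewrite /F pickleK asboolT//= in_itv /= px ltW.
Qed.

Context (a b : R).
Local Notation Omega := (`]a, b[%classic : set R).
Let mO : measurable (Omega : set T). Proof. exact: measurable_itv. Qed.

Lemma prim_ae_eq f g x : measurable_fun Omega f -> measurable_fun Omega g ->
  {ae leb, forall x, x \in Omega -> f x = g x} -> prim Omega f x = prim Omega g x.
Proof.
move=> mf mg fg; rewrite /prim /Rintegral; congr fine.
have mr h : measurable_fun Omega h -> measurable_fun (`]-oo, x]%classic : set T) (EFin \o (h \_ Omega)).
  move=> mh; apply/measurable_EFinP; apply: measurable_funTS.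
  exact/(measurable_restrictT _ _).1.
apply: ae_eq_integral => //; [exact: mr|exact: mr|].
apply: ae_imp fg => t h _; rewrite !patchE; case: ifPn => // tO; by rewrite h.
Qed.

Lemma prim_le_cst f s t M : leb.-integrable Omega (EFin \o f) -> a <= s -> s <= t -> t <= b ->
  (forall x, s <= x -> x <= t -> f x <= M) -> prim Omega f t - prim Omega f s <= M * (t - s).
Proof.
move=> fi as_ st tb fM; rewrite prim_sub// -Rintegral_itv_bndo_bndc; last first.
  by apply: integrableS (integrable_patch mO fi).
have vol : leb `]s, t[%classic = (t - s)%:E.
  by rewrite lebesgue_measure_itv /= lte_fin lt_neqAle st andbT; case: eqVneq => // ->; rewrite subrr.
apply: (@le_trans _ _ (\int[leb]_(x in `]s, t[) (cst M x))).
  apply: le_Rintegral => //.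
  - by apply: integrableS (integrable_patch mO fi).
  - by apply: integrable_cst_finite => //; rewrite [X in (X < _)%E]vol ltry.
  - move=> x; rewrite /= in_itv /= => /andP[sx xt]; rewrite patchE mem_setE in_itv /=.
    have [h1 h2] : a < x /\ x < b by split; lra.
    by rewrite h1 h2; apply: fM => //; lra.
rewrite Rintegral_cst//; change (M * fine (leb `]s, t[%classic) <= M * (t - s)).
by rewrite vol.
Qed.

Lemma prim_ge_cst f s t M : leb.-integrable Omega (EFin \o f) -> a <= s -> s <= t -> t <= b ->
  (forall x, s <= x -> x <= t -> M <= f x) -> M * (t - s) <= prim Omega f t - prim Omega f s.
Proof.
move=> fi as_ st tb fM.
have iN : leb.-integrable Omega (EFin \o (fun x => 0 - f x)).
  exact: (integrableB mO (integrable0 _ _) fi).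
have bnd x : s <= x -> x <= t -> 0 - f x <= - M.
  by move=> h1 h2; have := fM x h1 h2; lra.
have := prim_le_cst iN as_ st tb bnd.
rewrite !primB//; [|exact: integrable0..].
have -> : prim Omega (fun=> 0) t - prim Omega f t - (prim Omega (fun=> 0) s - prim Omega f s) =
  prim Omega (fun=> 0) t - prim Omega (fun=> 0) s - (prim Omega f t - prim Omega f s) by ring.
rewrite (prim_sub mO (integrable0 _ _) st).
have -> : \int[leb]_(x in `]s, t]) ((fun=> 0) \_ Omega) x = 0.
  by apply: Rintegral_eq0 => x _; rewrite patchE; case: ifP.
lra.
Qed.

Context (u : R -> R) (nu : {charge set T -> \bar R}) (c : R).
Context (ab : a < b) (iu : leb.-integrable Omega (EFin \o u))
  (hu : {ae leb, forall x, x \in Omega -> u x = c + cdfc nu x}).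

(** The right continuous representative of u, meaningful at every point. *)
Let k x := c + cdfc nu x.

Let mk : measurable_fun Omega k.
Proof. by apply: measurable_funD => //; exact: measurable_cdfc. Qed.

Let ik : leb.-integrable Omega (EFin \o k).
Proof.
have fO : (leb Omega < +oo)%E by rewrite lebesgue_measure_itv /= lte_fin ab ltry.
have i1 : leb.-integrable Omega (EFin \o cst 1) by exact: integrable_cst_finite.
have [M hM] := cdfc_bounded nu.
have := @integrable_mul_bounded R _ T leb Omega (cst 1) k (`|c| + M) mO i1 mk.
rewrite (_ : EFin \o (fun x => cst 1 x * k x) = EFin \o k); last first.
  by apply/funext => x /=; rewrite mul1r.
by apply => x _; apply: le_trans (ler_normD _ _) _; rewrite lerD2l.
Qed.

Let primE x : prim Omega u x = prim Omega k x.
Proof. by apply: prim_ae_eq => //; apply/measurable_EFinP; exact: measurable_int iu. Qed.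

Let rck t e : 0 < e -> exists2 d : R, 0 < d & forall x, t <= x -> x < t + d -> `|k x - k t| < e.
Proof.
move=> e0; have [d d0 hd] := cdfc_right_continuous nu t e0; exists d => // x tx xd.
by have := hd x tx xd; congr (`|_| < e); rewrite /k; ring.
Qed.

(** Convexity makes [k] nondecreasing, so the negative part of nu is dominated on ]p, q] by the
    positive part; being singular to it, it vanishes there. The room between q and q' is used by
    right continuity at q. *)
Lemma negv_null_cvx p q q' : a <= p -> p <= q -> q < q' -> q' <= b ->
  cvx_on p q' (prim Omega u) -> negv nu `]p, q]%classic = 0%E.
Proof.
move=> ap pq qq' q'b cv.
have mono s t : p <= s -> s <= t -> t < q' -> k s <= k t.
  move=> ps st tq'; apply: (cvx_slope_mono cv _ _ rck) ps st tq'.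
  - move=> s' t' M ps' st' tq' hM; rewrite !primE; apply: prim_le_cst => //.
      exact: le_trans ps'.
    exact/ltW/(lt_le_trans tq').
  - move=> s' t' M ps' st' tq' hM; rewrite !primE; apply: prim_ge_cst => //.
      exact: le_trans ps'.
    exact/ltW/(lt_le_trans tq').
have [N mN [N1 N2]] := posv_negv_singular nu.
apply: (le_singular_null mN _ N1 N2); first exact: measurable_itv.
apply: le_measure_cdf => // s t ps st tq.
by have := mono s t ps st (le_lt_trans tq qq'); rewrite /k lerD2l.
Qed.

Lemma posv_null_concave p q q' : a <= p -> p <= q -> q < q' -> q' <= b ->
  cvx_on p q' (fun x => - prim Omega u x) -> posv nu `]p, q]%classic = 0%E.
Proof.
move=> ap pq qq' q'b cv.
have mono s t : p <= s -> s <= t -> t < q' -> - k s <= - k t.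
  move=> ps st tq'; apply: (cvx_slope_mono (k := fun x => - k x) cv) ps st tq'.
  - move=> s' t' M ps' st' tq' hM; rewrite !primE.
    have := @prim_ge_cst k s' t' (- M) ik (le_trans ap ps') st' (ltW (lt_le_trans tq' q'b)).
    by move=> h; have := h (fun x h1 h2 => ltac:(rewrite lerNl; exact: hM)); lra.
  - move=> s' t' M ps' st' tq' hM; rewrite !primE.
    have := @prim_le_cst k s' t' (- M) ik (le_trans ap ps') st' (ltW (lt_le_trans tq' q'b)).
    by move=> h; have := h (fun x h1 h2 => ltac:(rewrite lerNr; exact: hM)); lra.
  - move=> t' e e0; have [d d0 hd] := rck t' e0; exists d => // x tx xd.
    by rewrite -opprD normrN; exact: hd.
have [N mN [N1 N2]] := posv_negv_singular nu.
apply: (@le_singular_null (negv nu) (posv nu) (~` N)) => //.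
- exact: measurableC.
- by rewrite setCK.
apply: le_measure_cdf => // s t ps st tq.
by have := mono s t ps st (le_lt_trans tq qq'); rewrite /k /cdfc; lra.
Qed.

(** The tail of u - g is G - U. A point of ]a, b[ where it differs from - al is off the upper wall,
    so U is concave nearby and small intervals around it are null for the positive part of nu;
    countably many of them cover all such points. The negative part is symmetric. *)
Lemma taut_saturated al g : leb.-integrable Omega (EFin \o g) ->
  taut a b al (prim Omega g) (prim Omega u) ->
  [/\ forall x, a <= x -> x <= b -> `|tail Omega (fun t => u t - g t) x| <= al x,
    forall x, ~ (a < x < b) -> tail Omega (fun t => u t - g t) x = 0,
    \int[leb]_(t in Omega) (u t - g t) = 0,
    {ae posv nu, forall x, x \in Omega -> tail Omega (fun t => u t - g t) x = - al x} &
    {ae negv nu, forall x, x \in Omega -> tail Omega (fun t => u t - g t) x = al x}].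
Proof.
move=> ig [_ Ua Ub h].
pose f t := u t - g t.
have if_ : leb.-integrable Omega (EFin \o f) by exact: (integrableB mO iu ig).
have tb x : b <= x -> tail Omega f x = 0.
  move=> bx; apply: Rintegral_eq0 => t /=; rewrite in_itv /= => /andP[_ tb].
  by rewrite leNgt (lt_le_trans tb bx) mulr0.
have i0 : \int[leb]_(t in Omega) f t = 0.
  have := tail_prim b mO if_; rewrite tb// primB// Ub subrr subr0 => <-//.
have tE x : tail Omega f x = - (prim Omega u x - prim Omega g x).
  by rewrite tail_prim// i0 sub0r primB.
split => //.
- by move=> x ax xb; rewrite tE normrN; have [] := h x ax xb.
- move=> x xO; have [xb|bx] := ltP x b; last exact: tb.
  have xa : x <= a by rewrite leNgt; apply/negP => ax; apply: xO; rewrite ax.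
  rewrite /tail -[RHS]i0; apply: eq_Rintegral => t; rewrite mem_setE in_itv /= => /andP[at_ _].
  by rewrite (le_trans xa (ltW at_)) mulr1.
- apply: (@negligibleS _ _ _ (posv nu) ([set x | a < x < b /\ tail Omega f x != - al x])).
    move=> x /= nx; have [xO|xO] := boolP (x \in Omega); last by exfalso; apply: nx => xO'; rewrite xO' in xO.
    split; first by move: xO; rewrite mem_setE in_itv.
    by apply/eqP => e; apply: nx.
  apply: (@negligible_cover _ a b); first by move=> x [? _] /=; rewrite in_itv.
  move=> x [/andP[ax xb] /eqP ne]; have [h1 h2 _] := h x (ltW ax) (ltW xb).
  have [|e e0 he] := h2.
    rewrite lt_neqAle (le_trans (ler_norm _) h1) andbT; apply/eqP => e.
    by apply: ne; rewrite tE e.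
  exists e => // p q ap xp pq qb qx.
  have qm : q < Num.min b (x + e) by rewrite lt_min qb.
  have mb : Num.min b (x + e) <= b by rewrite ge_min lexx.
  have me : Num.min b (x + e) <= x + e by rewrite ge_min lexx orbT.
  by apply: (@posv_null_concave p q (Num.min b (x + e))) => //; [exact: ltW|apply: he => //; exact: ltW].
- apply: (@negligibleS _ _ _ (negv nu) ([set x | a < x < b /\ tail Omega f x != al x])).
    move=> x /= nx; have [xO|xO] := boolP (x \in Omega); last by exfalso; apply: nx => xO'; rewrite xO' in xO.
    split; first by move: xO; rewrite mem_setE in_itv.
    by apply/eqP => e; apply: nx.
  apply: (@negligible_cover _ a b); first by move=> x [? _] /=; rewrite in_itv.
  move=> x [/andP[ax xb] /eqP ne]; have [h1 _ h2] := h x (ltW ax) (ltW xb).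
  have [|e e0 he] := h2.
    rewrite lt_neqAle; apply/andP; split; last by move: h1; rewrite ler_norml => /andP[].
    by apply/eqP => e; apply: ne; rewrite tE -e opprK.
  exists e => // p q ap xp pq qb qx.
  have qm : q < Num.min b (x + e) by rewrite lt_min qb.
  have mb : Num.min b (x + e) <= b by rewrite ge_min lexx.
  have me : Num.min b (x + e) <= x + e by rewrite ge_min lexx orbT.
  by apply: (@negv_null_cvx p q (Num.min b (x + e))) => //; [exact: ltW|apply: he => //; exact: ltW].
Qed.

End saturation.

(** * BV functions with a prescribed primitive *)

Section construction.
Context {R : realType}.
Local Notation T := (measurableTypeR R).
Local Notation leb := (@lebesgue_measure R).
Context (a b : R).
Local Notation Omega := (`]a, b[%classic : set R).
Let mO : measurable (Omega : set T). Proof. exact: measurable_itv. Qed.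
Implicit Types (E V U A B : R -> R).

(** Over n + 1 equal pieces of [a, x] the bounds add up to (V x - V a) (x - a) / (n + 1), since the
    increments of V telescope. *)
Lemma increment_const E V : a < b -> {homo V : x y / x <= y} ->
  (forall x y, a <= x -> x <= y -> y <= b -> `|E y - E x| <= (V y - V x) * (y - x)) ->
  forall x, a <= x -> x <= b -> E x = E a.
Proof.
move=> ab nV hE x ax xb.
have part n : `|E x - E a| <= (V x - V a) * ((x - a) / n.+1%:R).
  have n0 : 0 < n.+1%:R :> R by [].
  pose h := (x - a) / n.+1%:R; have h0 : 0 <= h by rewrite divr_ge0// subr_ge0.
  have hn : h * n.+1%:R = x - a by rewrite divfK// gt_eqF.
  have step k : (k <= n.+1)%N -> `|E (a + h * k%:R) - E a| <= (V (a + h * k%:R) - V a) * h.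
    elim: k => [_|k IH kn]; first by rewrite mulr0 addr0 !subrr normr0 mul0r.
    have s1 := IH (ltnW kn).
    have kx : a + h * k.+1%:R <= b.
      apply: le_trans xb; have : h * k.+1%:R <= h * n.+1%:R by rewrite ler_wpM2l// ler_nat.
      lra.
    have hk : 0 <= h * k%:R by rewrite mulr_ge0.
    have kS : h * k.+1%:R = h * k%:R + h by rewrite -natr1 mulrDr mulr1.
    have s2 := hE (a + h * k%:R) (a + h * k.+1%:R) ltac:(lra) ltac:(lra) kx.
    have -> : E (a + h * k.+1%:R) - E a =
      (E (a + h * k.+1%:R) - E (a + h * k%:R)) + (E (a + h * k%:R) - E a) by lra.
    apply: le_trans (ler_normD _ _) _; apply: le_trans (lerD s2 s1) _.
    have -> : a + h * k.+1%:R - (a + h * k%:R) = h by lra.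
    by rewrite -mulrDl ler_wpM2r//; lra.
  have := step n.+1 (leqnn _); rewrite hn.
  by have -> : a + (x - a) = x by lra.
apply/eqP; rewrite -subr_eq0 -normr_eq0 eq_le normr_ge0 andbT.
have VV : 0 <= (V x - V a) * (x - a) by rewrite mulr_ge0 ?subr_ge0// nV.
apply/ler_addgt0Pr => e e0; rewrite add0r.
have [n hn] : exists n : nat, (V x - V a) * (x - a) / e < n.+1%:R.
  exists (Num.trunc ((V x - V a) * (x - a) / e)).
  by have := truncnS_gt ((V x - V a) * (x - a) / e).
apply: le_trans (part n) _; rewrite mulrA ler_pdivrMr//.
by apply/ltW; rewrite [ltRHS]mulrC -ltr_pdivrMr.
Qed.

(** Gives access to [cdfc] when nu is built as a difference of measures, which may differ from its
    Jordan parts. *)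
Lemma cdfcE (nu : {charge set T -> \bar R}) t : cdfc nu t = fine (nu `]-oo, t]%classic).
Proof.
by rewrite posv_negv ?fineB ?fin_num_measure//; exact: measurable_itv.
Qed.

(** The charge is the difference of the Stieltjes measures of A and B restricted to ]a,
    b[; the restrictions are finite because ]a, b] has mass A b - A a, respectively B b - B a. *)
Lemma charge_of_increments A B : a < b -> rc_nondecreasing A -> rc_nondecreasing B ->
  exists nu : {charge set T -> \bar R},
    (forall X : set T, measurable X -> nu X = nu (X `&` Omega)) /\
    forall t, a < t -> t < b -> cdfc nu t = (A t - A a) - (B t - B a).
Proof.
move=> ab rA rB.
have main C : rc_nondecreasing C -> exists m : {finite_measure set T -> \bar R},
    (forall X : set T, m X = m (X `&` Omega)) /\
    forall t, a < t -> t < b -> m `]-oo, t]%classic = (C t - C a)%:E.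
  move=> rC; have [mu hmu] := stieltjes_measure rC.
  have fin : (mu Omega < +oo)%E.
    apply: (@le_lt_trans _ _ (mu `]a, b]%classic)); last by rewrite hmu ?ltry// ltW.
    by apply: le_measure; rewrite ?inE//; apply: subset_itvl; rewrite bnd_simp.
  exists (mfrestr mO fin); split.
    by move=> X; rewrite /= /mfrestr /mrestr -setIA setIid.
  move=> t at_ tb; rewrite /= /mfrestr /mrestr -hmu; last exact: ltW.
  congr (mu _); apply/seteqP; split => x /=; rewrite !in_itv /=.
    by move=> [xt /andP[-> _]].
  by move=> /andP[ax xt]; split => //; rewrite ax (le_lt_trans xt tb).
have [mA [rA1 rA2]] := main A rA; have [mB [rB1 rB2]] := main B rB.
pose nu : {charge set T -> \bar R} :=
  cadd (charge_of_finite_measure mA) (cscale (-1) (charge_of_finite_measure mB)).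
have nuE X : nu X = (mA X - mB X)%E.
  transitivity (mA X + (-1)%:E * mB X)%E; first by [].
  by rewrite EFinN mulN1e.
exists nu; split.
  by move=> X mX; rewrite !nuE rA1 rB1.
by move=> t at_ tb; rewrite cdfcE nuE rA2// rB2.
Qed.

Lemma density_BV U A B : a < b -> rc_nondecreasing A -> rc_nondecreasing B ->
  density a b U A B ->
  exists n : BVspace a b, forall x, a <= x -> x <= b -> prim Omega n x = U x - U a.
Proof.
move=> ab rA rB den; pose n x := A x - B x.
have [nu [nuO nuE]] := charge_of_increments ab rA rB.
have fO : (leb Omega < +oo)%E by rewrite lebesgue_measure_itv /= lte_fin ab ltry.
have i1 : leb.-integrable Omega (EFin \o cst 1) by exact: integrable_cst_finite.
have inn : leb.-integrable Omega (EFin \o n).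
  rewrite (_ : EFin \o n = EFin \o (fun x => cst 1 x * n x)); last first.
    by apply/funext => x /=; rewrite mul1r.
  apply: (@integrable_mul_bounded _ _ _ _ _ _ _ (`|A a| + `|A b| + `|B a| + `|B b|)) => //.
    by apply: measurable_funB; apply: nondecreasing_measurable => //; [exact: rA.1|exact: rB.1].
  move=> x; rewrite /= in_itv /= => /andP[ax xb].
  have := rA.1 _ _ (ltW ax); have := rA.1 _ _ (ltW xb).
  have := rB.1 _ _ (ltW ax); have := rB.1 _ _ (ltW xb).
  have := ler_norm (A b); have := ler_norm (- A a); have := ler_norm (B b); have := ler_norm (- B a).
  have := normr_ge0 (A b); have := normr_ge0 (A a); have := normr_ge0 (B a); have := normr_ge0 (B b).
  by rewrite !normrN ler_norml /n => *; apply/andP; split; lra.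
have der : is_distributional_derivative a b n nu.
  apply: (@is_distributional_derivative_cdfc _ _ _ _ _ (A a - B a)) => //.
  apply: aeW => x; rewrite mem_setE in_itv /= => /andP[ax xb]; rewrite nuE// /n; lra.
exists (MkBVspace inn (ex_intro _ nu der)) => x ax xb /=.
pose E x := U x - prim Omega n x.
suff : E x = E a.
  by rewrite /E prim_left; lra.
(* Factor 2: over [s, t], U and the primitive of n each differ from slope n s by at most the
   increments of A and B times t - s. *)
apply: (@increment_const E (fun x => 2 * (A x + B x))) => //.
  by move=> s t st; have := rA.1 _ _ st; have := rB.1 _ _ st; lra.
move=> s t as_ st tb; have := den s t as_ st tb.
have up := @prim_le_cst _ a b n s t (n s + ((A t - A s) + (B t - B s))) inn as_ st tb.
have lo := @prim_ge_cst _ a b n s t (n s - ((A t - A s) + (B t - B s))) inn as_ st tb.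
have {}up := up (fun y sy yt => ltac:(have := rA.1 _ _ sy; have := rA.1 _ _ yt;
  have := rB.1 _ _ sy; have := rB.1 _ _ yt; rewrite /n; lra)).
have {}lo := lo (fun y sy yt => ltac:(have := rA.1 _ _ sy; have := rA.1 _ _ yt;
  have := rB.1 _ _ sy; have := rB.1 _ _ yt; rewrite /n; lra)).
rewrite !ler_norml /E => /andP[h1 h2].
by rewrite /n in up lo; apply/andP; split; lra.
Qed.

End construction.

(** * Minimality of the taut string *)

Section minimisers.
Context {R : realType} (a b : R) (ab : a < b).
Local Notation T := (measurableTypeR R).
Local Notation leb := (@lebesgue_measure R).
Local Notation Omega := (`]a, b[%classic : set R).
Let mO : measurable (Omega : set T). Proof. exact: measurable_itv. Qed.
Implicit Types (nu : {charge set T -> \bar R}) (g u z : BVspace a b) (h al : R -> R).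

Definition total_variation al nu : R :=
  \int[posv nu]_(x in Omega) al x + \int[negv nu]_(x in Omega) al x.

Lemma integrable_bounded (m : {finite_measure set T -> \bar R}) al M :
  measurable_fun Omega al -> (forall x, Omega x -> `|al x| <= M) ->
  m.-integrable Omega (EFin \o al).
Proof.
move=> mal hM; have fO : (m Omega < +oo)%E by rewrite ltey_eq fin_num_measure.
have i1 : m.-integrable Omega (EFin \o cst 1) by exact: integrable_cst_finite.
rewrite (_ : EFin \o al = EFin \o (fun x => cst 1 x * al x)); last first.
  by apply/funext => x /=; rewrite mul1r.
exact: (@integrable_mul_bounded _ _ _ _ _ _ _ M).
Qed.

Lemma integral_variation al nu M : measurable_fun Omega al ->
  (forall x, Omega x -> 0 <= al x <= M) ->
  (\int[Defs.variation nu]_(x in Omega) (al x)%:E = (total_variation al nu)%:E)%E.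
Proof.
move=> mal hM.
have al0 x : Omega x -> (0 <= (al x)%:E)%E by move=> /hM /andP[]; rewrite lee_fin.
have hM' x : Omega x -> `|al x| <= M by move=> /hM /andP[h0 h1]; rewrite ger0_norm.
have i1 := integrable_bounded (posv nu) mal hM'; have i2 := integrable_bounded (negv nu) mal hM'.
transitivity (\int[measure_add (posv nu) (negv nu)]_(x in Omega) (al x)%:E)%E.
  apply: eq_measure_integral => A mA _; rewrite [RHS]measure_addE.
  by transitivity (posv nu A + negv nu A)%E.
rewrite ge0_integral_measure_add//; last exact/measurable_EFinP.
rewrite /total_variation EFinD /Rintegral !fineK//; exact: integrable_fin_num.
Qed.

Lemma integrable_ae_eq f h : leb.-integrable Omega (EFin \o f) -> measurable_fun Omega h ->
  {ae leb, forall x, x \in Omega -> f x = h x} -> leb.-integrable Omega (EFin \o h).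
Proof.
move=> fi mh fh; have mf : measurable_fun Omega f.
  by apply/measurable_EFinP; exact: measurable_int fi.
apply/integrableP; split; first exact/measurable_EFinP.
have [_] := integrableP _ _ _ fi; congr (_ < _)%E; apply: ae_eq_integral => //.
- by apply/measurable_EFinP; exact: measurableT_comp.
- by apply/measurable_EFinP; exact: measurableT_comp.
- by apply: ae_imp fh => x e /mem_set /e /= ->.
Qed.

(** In one dimension BV functions are essentially bounded; this makes the products and squares in
    the energy integrable. *)
Lemma BVspace_representation z : exists c M, [/\
  {ae leb, forall x, x \in Omega -> z x = c + cdfc (distD z) x},
  forall x, `|c + cdfc (distD z) x| <= M & measurable_fun Omega z].
Proof.
have [c hc] := BV_representation ab (BV_integrable z) (projT2 (cid (BV_derivative z))).
have [M hM] := cdfc_bounded (distD z).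
exists c, (`|c| + M); split => //.
- by move=> x; apply: le_trans (ler_normD _ _) _; rewrite lerD2l.
- by apply/measurable_EFinP; exact: measurable_int (BV_integrable z).
Qed.

Lemma integrable_mul_BV h z : leb.-integrable Omega (EFin \o h) ->
  leb.-integrable Omega (EFin \o (fun x => h x * z x)).
Proof.
move=> ih; have [c [M [hz hM mz]]] := BVspace_representation z.
have mh : measurable_fun Omega h by apply/measurable_EFinP; exact: measurable_int ih.
apply: (@integrable_ae_eq (fun x => h x * (c + cdfc (distD z) x))).
- apply: (@integrable_mul_bounded _ _ _ _ _ _ _ M) => //.
  by apply: measurable_funD => //; exact: measurable_cdfc.
- exact: measurable_funM.
- by apply: ae_imp hz => x e /e ->.
Qed.

(** Integration by parts; the constant in the representation of z disappears because h has mean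
    zero. *)
Lemma BV_pairing h z : leb.-integrable Omega (EFin \o h) ->
  \int[leb]_(x in Omega) h x = 0 ->
  \int[leb]_(x in Omega) (h x * z x) = charge_integral (distD z) (tail Omega h).
Proof.
move=> ih h0; have [c [M [hz hM mz]]] := BVspace_representation z.
have mh : measurable_fun Omega h by apply/measurable_EFinP; exact: measurable_int ih.
rewrite charge_integral_tail//.
have ic := integrable_mul_cdfc (distD z) mO ih; have ik := integrableZl mO c ih.
transitivity (\int[leb]_(x in Omega) (c * h x + h x * cdfc (distD z) x)).
  apply: ae_eq_Rintegral_itv.
  - exact: measurable_funM.
  - apply: measurable_funD; apply: measurable_funM => //; exact: measurable_cdfc.
  - by apply: ae_imp hz => x e /e ->; rewrite mulrDr [X in X + _]mulrC.
by rewrite (RintegralD mO ik ic) (RintegralZl c mO ih) h0 mulr0 add0r.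
Qed.

Lemma integrable_sub_BV u z : leb.-integrable Omega (EFin \o (fun x => u x - z x)).
Proof. exact: (integrableB mO (BV_integrable u) (BV_integrable z)). Qed.

Lemma integrable_sqr_BV u z : leb.-integrable Omega (EFin \o (fun x => (u x - z x) ^+ 2)).
Proof.
have i := integrable_sub_BV u z.
have := integrableB mO (integrable_mul_BV u i) (integrable_mul_BV z i).
by congr (_.-integrable _ _); apply/funext => x /=; rewrite -EFinB -mulrBr.
Qed.

Lemma energyE al M g z : measurable_fun Omega al -> (forall x, Omega x -> 0 <= al x <= M) ->
  energy al g z = (2^-1 * \int[leb]_(x in Omega) (g x - z x) ^+ 2 + total_variation al (distD z))%:E.
Proof.
move=> mal hM; rewrite /energy (integral_variation _ mal hM) [RHS]EFinD [in RHS]EFinM.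
congr (_ * _ + _)%E; rewrite /Rintegral fineK//.
exact: integrable_fin_num (integrable_sqr_BV g z).
Qed.

(* With h = u - g, the polarisation identity leaves the cross term [\int h (z - u)],
   which is bounded below through the pairing of [tail Omega h] with the derivatives
   of z and u. *)
Lemma taut_energy al M g u z : measurable_fun Omega al ->
  (forall x, Omega x -> 0 <= al x <= M) ->
  taut a b al (prim Omega g) (prim Omega u) ->
  2^-1 * \int[leb]_(x in Omega) (g x - u x) ^+ 2 + total_variation al (distD u) +
    2^-1 * \int[leb]_(x in Omega) (u x - z x) ^+ 2 <=
  2^-1 * \int[leb]_(x in Omega) (g x - z x) ^+ 2 + total_variation al (distD z).
Proof.
move=> mal hM tau.
have [c [N [hu _ _]]] := BVspace_representation u.
have [t_le t0 h0 sp sn] := taut_saturated ab (BV_integrable u) hu (BV_integrable g) tau.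
set h := (fun t => u t - g t) in t_le t0 h0 sp sn.
have ih : leb.-integrable Omega (EFin \o h) by exact: integrable_sub_BV.
have hM' x : Omega x -> `|al x| <= M by move=> /hM /andP[k0 k1]; rewrite ger0_norm.
(* [charge_integral] runs over the whole line and the total variation over ]a,
   b[; the tail vanishes outside ]a, b[, which reconciles them. *)
have tO (m : {finite_measure set T -> \bar R}) :
    \int[m]_x tail Omega h x = \int[m]_(x in Omega) tail Omega h x.
  rewrite [RHS]Rintegral_mkcond; apply: eq_Rintegral => x _; rewrite patchE mem_setE in_itv /=.
  by case: ifPn => // /negP; exact: t0.
have mt : measurable_fun Omega (tail Omega h).
  have [i _ _] := fubini_tail (posv (distD u)) mO ih.
  by apply: measurable_funTS; apply/measurable_EFinP; exact: measurable_int i.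
have tM x : Omega x -> `|tail Omega h x| <= M.
  move=> xO; have /andP[ax xb] : a < x < b by move: xO; rewrite /= in_itv.
  by apply: le_trans (t_le x (ltW ax) (ltW xb)) _; have /andP[] := hM x xO.
have pz : - total_variation al (distD z) <= charge_integral (distD z) (tail Omega h).
  have bd (m : {finite_measure set T -> \bar R}) :
      `|\int[m]_x tail Omega h x| <= \int[m]_(x in Omega) al x.
    have it := integrable_bounded m mt tM; have ia := integrable_bounded m mal hM'.
    rewrite tO; apply: le_trans (le_normr_Rintegral mO it) _.
    apply: le_Rintegral => //.
      by have := integrable_norm it.
    move=> x xO; apply: t_le; move: xO; rewrite /= in_itv => /andP[*]; exact: ltW.
  have := bd (posv (distD z)); have := bd (negv (distD z)).
  rewrite -[charge_integral _ _]/(\int[posv (distD z)]_x tail Omega h x - \int[negv (distD z)]_x tail Omega h x).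
  rewrite /total_variation !ler_norml.
  set i1 := \int[posv _]_x _; set i2 := \int[negv _]_x _.
  set i3 := \int[posv _]_(x in _) _; set i4 := \int[negv _]_(x in _) _.
  clearbody i1 i2 i3 i4 => /andP[? ?] /andP[? ?]; lra.
have pu : charge_integral (distD u) (tail Omega h) = - total_variation al (distD u).
  rewrite -[charge_integral _ _]/(\int[posv (distD u)]_x tail Omega h x - \int[negv (distD u)]_x tail Omega h x).
  have aeR (m : {finite_measure set T -> \bar R}) (k : R -> R) : measurable_fun Omega k ->
      {ae m, forall x, Omega x -> tail Omega h x = k x} ->
      \int[m]_x tail Omega h x = \int[m]_(x in Omega) k x.
    move=> mk hk; rewrite tO /Rintegral; congr fine; apply: ae_eq_integral => //.
    - exact/measurable_EFinP.
    - exact/measurable_EFinP.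
    - by apply: ae_imp hk => x hx /hx ->.
  have mN : measurable_fun Omega (fun x => - al x) by exact: measurable_funN.
  rewrite (aeR _ _ mN); last by apply: ae_imp sp => x e /mem_set.
  rewrite (aeR _ _ mal); last by apply: ae_imp sn => x e /mem_set.
  have -> : \int[posv (distD u)]_(x in Omega) - al x = - \int[posv (distD u)]_(x in Omega) al x.
    have ia := integrable_bounded (posv (distD u)) mal hM'.
    rewrite -[RHS]mulN1r -(RintegralZl (-1) mO ia).
    by apply: eq_Rintegral => x _; rewrite mulN1r.
  by rewrite /total_variation -opprD.
have cross : 2^-1 * \int[leb]_(x in Omega) (g x - z x) ^+ 2 =
    2^-1 * \int[leb]_(x in Omega) (g x - u x) ^+ 2 +
    2^-1 * \int[leb]_(x in Omega) (u x - z x) ^+ 2 +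
    (\int[leb]_(x in Omega) (h x * z x) - \int[leb]_(x in Omega) (h x * u x)).
  have i1 := integrable_sqr_BV g u; have i2 := integrable_sqr_BV u z.
  have i3 := integrable_mul_BV z ih; have i4 := integrable_mul_BV u ih.
  have i5 := integrableB mO i3 i4.
  have i6 := integrableZl mO 2 i5.
  have i7 := integrableD mO i1 i2.
  rewrite -(RintegralB mO i3 i4).
  have -> : \int[leb]_(x in Omega) (g x - z x) ^+ 2 =
      \int[leb]_(x in Omega) (((g x - u x) ^+ 2 + (u x - z x) ^+ 2) + 2 * (h x * z x - h x * u x)).
    by apply: eq_Rintegral => x _; rewrite /h; ring.
  rewrite (RintegralD mO i7 i6) (RintegralD mO i1 i2) (RintegralZl 2 mO i5).
  rewrite !mulrDr; congr (_ + _ + _).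
  by rewrite mulrA mulVf ?mul1r.
have pzE := BV_pairing z ih h0; have puE := BV_pairing u ih h0.
rewrite cross pzE puE pu; move: pz.
set i1 := \int[leb]_(x in _) (_ - _) ^+ 2; set i2 := \int[leb]_(x in _) (_ - _) ^+ 2.
set i3 := total_variation _ _; set i4 := total_variation _ _; set i5 := charge_integral _ _.
by clearbody i1 i2 i3 i4 i5; clear => le_i5; lra.
Qed.

End minimisers.

(** * The chosen minimiser and the taut string *)

Section minimiser_is_taut.
Context {R : realType} (a b : R) (ab : a < b).
Local Notation T := (measurableTypeR R).
Local Notation leb := (@lebesgue_measure R).
Local Notation Omega := (`]a, b[%classic : set R).
Let mO : measurable (Omega : set T). Proof. exact: measurable_itv. Qed.
Implicit Types (g u z : BVspace a b) (U V al : R -> R).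

Lemma measurable_BV z : measurable_fun Omega z.
Proof. by apply/measurable_EFinP; exact: measurable_int (BV_integrable z). Qed.

(** As u is a minimiser, [xget] returns a minimiser w and not its default. The energy of w is at
    most that of u, so the quadratic remainder in [taut_energy] for z = w must vanish. *)
Lemma taut_argminS al M g u : measurable_fun Omega al ->
  (forall x, Omega x -> 0 <= al x <= M) ->
  taut a b al (prim Omega g) (prim Omega u) ->
  {ae leb, forall x, x \in Omega -> argminS al g x = u x}.
Proof.
move=> mal hM tau.
have int_ge0 z : 0 <= \int[leb]_(x in Omega) (u x - z x) ^+ 2.
  by apply: Rintegral_ge0 => x _; exact: sqr_ge0.
have minu : argmin_energy al g u.
  move=> z; rewrite !(energyE ab _ _ mal hM) lee_fin.
  by have le := taut_energy ab z mal hM tau; apply: le_trans le; rewrite lerDl mulr_ge0.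
pose w := argminS al g.
have minw : argmin_energy al g w by exact: xgetI minu.
have le_uw := minw u; rewrite !(energyE ab _ _ mal hM) lee_fin in le_uw.
have int0 : \int[leb]_(x in Omega) (u x - w x) ^+ 2 = 0.
  apply/eqP; rewrite eq_le int_ge0 andbT -(@pmulr_rle0 _ 2^-1)//.
  by have := le_trans (taut_energy ab w mal hM tau) le_uw; rewrite gerDl.
have isq := integrable_sqr_BV ab u w.
pose k := EFin \o (fun x => (u x - w x) ^+ 2).
have mk : measurable_fun Omega k by exact: measurable_int isq.
have /(ae_eq_integral_abs leb mO mk).1 : (\int[leb]_(x in Omega) `|k x|)%E = 0%E.
  transitivity (\int[leb]_(x in Omega) k x)%E.
    by apply: eq_integral => x _ /=; rewrite ger0_norm// sqr_ge0.
  by rewrite -(fineK (integrable_fin_num mO isq)) -[fine _]/(\int[leb]_(x in Omega) _) int0.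
apply: ae_imp => x hx /set_mem /hx /= [] /eqP.
by rewrite sqrf_eq0 subr_eq0 => /eqP.
Qed.

(** The primitive is Lipschitz, z being essentially bounded. *)
Lemma cont_on_prim z : cont_on a b (prim Omega z).
Proof.
have [c [M [hz hM mz]]] := BVspace_representation ab z.
have mr : measurable_fun Omega (fun x => c + cdfc (distD z) x).
  by apply: measurable_funD => //; exact: measurable_cdfc.
have ir : leb.-integrable Omega (EFin \o (fun x => c + cdfc (distD z) x)).
  exact: (integrable_ae_eq (BV_integrable z) mr hz).
have lip x y : x <= y -> `|prim Omega z y - prim Omega z x| <= `|M| * (y - x).
  by rewrite !(prim_ae_eq _ mz mr hz); apply: prim_lipschitz.
have {lip}lip x y : `|prim Omega z y - prim Omega z x| <= `|M| * `|y - x|.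
  have [xy|/ltW yx] := leP x y; first by rewrite (ger0_norm (x := y - x)) ?lip// subr_ge0.
  by rewrite distrC (distrC y) (ger0_norm (x := x - y)) ?lip// subr_ge0.
move=> t _ _ e e0; have M0 : 0 < `|M| + 1 by rewrite ltr_wpDl.
exists (e / (`|M| + 1)); first exact: divr_gt0.
move=> x _ _; rewrite ltr_pdivlMr// => xt.
apply: le_lt_trans (lip _ _) (le_lt_trans _ xt).
by rewrite mulrC ler_wpM2l// lerDl.
Qed.

Lemma cvx_on_ext U V p q : (forall x, p <= x -> x <= q -> U x = V x) ->
  cvx_on p q U -> cvx_on p q V.
Proof.
move=> UV cv x y z px xy yz zq.
by rewrite -!UV; [exact: cv|lra..].
Qed.

Lemma locally_cvx_ext U V t : (forall x, a <= x -> x <= b -> U x = V x) ->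
  locally_cvx a b U t -> locally_cvx a b V t.
Proof.
move=> UV [e e0 cv]; exists e => // p q ap tp qb qt.
by apply: cvx_on_ext (cv p q ap tp qb qt) => x px xq; apply: UV; lra.
Qed.

Lemma taut_ext al G U V : (forall x, a <= x -> x <= b -> U x = V x) ->
  taut a b al G U -> taut a b al G V.
Proof.
move=> UV [cU Ua Ub h]; split.
- move=> t at_ tb e e0; have [d d0 hd] := cU t at_ tb e e0; exists d => // x ax xb.
  by rewrite -!UV//; exact: hd.
- by rewrite -UV// ltW.
- by rewrite -UV// ltW.
- move=> t at_ tb; have [h1 h2 h3] := h t at_ tb; rewrite -UV//; split => //.
    by move=> /h2; apply: locally_cvx_ext => x ax xb; rewrite UV.
  by move=> /h3; apply: locally_cvx_ext.
Qed.

Lemma BV_taut_exists al g : cont_on a b al -> (forall x, a <= x -> x <= b -> 0 < al x) ->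
  exists u : BVspace a b, taut a b al (prim Omega g) (prim Omega u).
Proof.
move=> cal al0.
have [U tau] := taut_exists ab cal (cont_on_prim g) al0.
have [A [B [rA rB den]]] := taut_has_density ab al0 tau.
have [u hu] := density_BV ab rA rB den.
exists u; apply: (taut_ext _ tau) => x ax xb; rewrite hu//.
suff -> : U a = 0 by rewrite subr0.
by have [_ -> _ _] := tau; exact: prim_left.
Qed.

Lemma continuous_cont_on al : {within `[a, b], continuous al} -> cont_on a b al.
Proof.
move=> /subspace_continuousP ca t at_ tb e e0.
have /(_ _)/cvgrPdist_lt/(_ e e0) := ca t; rewrite /= in_itv /= at_ tb => /(_ isT).
move=> [d d0 hd]; exists d => // x ax xb xt.
by rewrite distrC; apply: hd => /=; rewrite ?in_itv/= ?ax ?xb// distrC.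
Qed.

End minimiser_is_taut.

Unset Implicit Arguments.

Theorem proposition3p12 (R : realType) (a b : R) (hab : a < b)
    (f : BVspace a b) (alpha1 : R -> R)
    (halpha1_cont : {within `[a, b], continuous alpha1})
    (halpha1_pos : forall x, x \in `[a, b] -> 0 < alpha1 x)
    (alpha2 : R) (halpha2_pos : 0 < alpha2) :
  {ae lebesgue_measure, forall x : R, x \in `]a, b[ ->
    argminS (fun y => alpha1 y + alpha2) f x =
    argminS (fun=> alpha2) (argminS alpha1 f) x}.
Proof.
have ca1 := continuous_cont_on halpha1_cont.
have a1_gt0 x : a <= x -> x <= b -> 0 < alpha1 x.
  by move=> ax xb; apply: halpha1_pos; rewrite in_itv /= ax.
have ca2 : cont_on a b (fun=> alpha2).
  by move=> t _ _ e e0; exists 1 => // x _ _ _; rewrite subrr normr0.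
have [M hM] := cont_on_bounded (ltW hab) ca1.
pose Omega : set (measurableTypeR R) := `]a, b[%classic.
have a1M x : Omega x -> 0 <= alpha1 x <= M.
  rewrite /Omega /= in_itv /= => /andP[/ltW ax /ltW xb].
  by rewrite ltW ?a1_gt0// (le_trans (ler_norm _)) ?hM.
have ma1 : measurable_fun Omega alpha1.
  apply: (@measurable_funS _ _ _ _ `[a, b]%classic); first exact: measurable_itv.
    exact: subset_itvW.
  by apply: subspace_continuous_measurable_fun => //; exact: measurable_itv.
have [u1 tau1] := BV_taut_exists hab f ca1 a1_gt0.
have ae1 := taut_argminS hab ma1 a1M tau1.
set w1 := argminS alpha1 f in ae1 *.
have [u2 tau2] := BV_taut_exists hab w1 ca2 (fun _ _ _ => halpha2_pos).
have ma2 : measurable_fun Omega (fun=> alpha2) by exact: measurable_cst.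
have ae2 : {ae lebesgue_measure, forall x, x \in Omega -> argminS (fun=> alpha2) w1 x = u2 x}.
  by apply: (taut_argminS hab (M := alpha2) ma2) tau2 => x _; rewrite ltW//=.
(* [w1] and [u1] agree only almost everywhere, but their primitives coincide, so [u2] is taut around
   the string of [u1] and tautness can be composed. *)
have wE : prim Omega w1 = prim Omega u1.
  by apply/funext => x; apply: prim_ae_eq => //; exact: measurable_BV.
have tau12 := taut_trans halpha2_pos tau1 (eq_rect _ (fun G => taut a b _ G _) tau2 _ wE).
have ae12 : {ae lebesgue_measure, forall x, x \in Omega ->
    argminS (fun y => alpha1 y + alpha2) f x = u2 x}.
  apply: (taut_argminS hab (M := M + alpha2) _ _ tau12).
    exact: measurable_funD.
  by move=> x /a1M /andP[? ?]; rewrite addr_ge0 ?lerD2r// ltW.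
by apply: ae_imp2 ae12 ae2 => x e12 e2 /mem_set xO; rewrite e12 ?e2.
Qed.
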